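(* Let $\{S,A,(A(i),i\in S),q(j|i,a),c(i,a)\}$ be a continuous-time Markov decision model as described in the context, where $S$ is a finite set, and let $\lambda>0$. Assume: (i) for each $i\in S$, the set $A(i)$ is compact; (ii) for each $i,j\in S$, the functions $c(i,a)$ and $q(j|i,a)$ are continuous in $a\in A(i)$; (iii) for each $f\in F$, the corresponding continuous-time Markov chain $\{\xi_t,t\ge 0\}$ is irreducible, i.e., for any two states $i\neq j$ there exist different states $j_1=i,j_2,\ldots,j_m$ such that $q(j_2|j_1,f)\cdots q(j|j_m,f)>0$. Fix any state $z\in S$ and let $h_g(i,f)$, $h_g^*(i)$, $Q(i,a,g)$, $Q(i,f,g)$, $G$ and $\overline{g}$ be as defined in the context. Then the following statements hold. (a) The set $G$ is nonempty. (b) For each $g\in\mathbb{R}$ and $f\in F$, the function $h_g(\cdot,f)$ on $S$ satisfies $$e^{\lambda h_{g}(i,f)}=Q(i,f,g)\Big(q(z|i,f)+\sum_{j\in S\setminus\{i,z\}}e^{\lambda h_{g}(j,f)}q(j|i,f)\Big)\quad\text{for all } i\in S\setminus\{z\},$$ $$e^{\lambda h_{g}(z,f)}=Q(z,f,g)\sum_{j\in S\setminus\{z\}}e^{\lambda h_{g}(j,f)}q(j|z,f).$$ (c) For each $g\in\mathbb{R}$ and $i\in S$, the function $Q(i,a,g)$ is continuous in $a\in A(i)$. Moreover, for each $g\in\mathbb{R}$, the function $Q(i,a,g)\big(q(z|i,a)+\sum_{j\in S\setminus\{i,z\}}e^{\lambda h^*_{g}(j)}q(j|i,a)\big)$ (for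 $i\in S\setminus\{z\}$) is lower semi-continuous in $a\in A(i)$, and the function $Q(z,a,g)\sum_{j\in S\setminus\{z\}}e^{\lambda h^*_{g}(j)}q(j|z,a)$ is lower semi-continuous in $a\in A(z)$. (d) For each $g\in G$, the function $h_g^*$ on $S$ satisfies the equations $$e^{\lambda h^*_{g}(i)}=\inf_{a\in A(i)}\Big\{Q(i,a,g)\Big(q(z|i,a)+\sum_{j\in S\setminus\{i,z\}}e^{\lambda h^*_{g}(j)}q(j|i,a)\Big)\Big\}\quad\text{for all } i\in S\setminus\{z\},$$ $$e^{\lambda h^*_{g}(z)}=\inf_{a\in A(z)}\Big\{Q(z,a,g)\sum_{j\in S\setminus\{z\}}e^{\lambda h^*_{g}(j)}q(j|z,a)\Big\}.$$ Moreover, there exists a policy $f_g\in F$ such that, for every $i\in S$, $f_g(i)\in A(i)$ attains the minimum in the equation for state $i$; and for any $f_g\in F$ such that, for every $i\in S$, $f_g(i)\in A(i)$ attains the minimum in the equation for state $i$, we have $h_g(i,f_g)=h_g^*(i)\in\mathbb{R}$ and $Q(i,f_g,g)<\infty$ for all $i\in S$. (e) We have $\overline{g}\in G$ and $h^*_{\overline{g}}(z)=0$.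
   Context: Model. $S$ is a finite set (state space, discrete topology); $A$ is a Borel space (action space) with Borel $\sigma$-algebra $\mathcal{B}(A)$; for each $i\in S$, $A(i)\in\mathcal{B}(A)$ is the set of admissible actions in state $i$; $K:=\{(i,a)\,|\,i\in S,\ a\in A(i)\}$. The transition rates $q(j|i,a)$ are real-valued, measurable in $a\in A(i)$ for each $i,j\in S$, satisfy $q(j|i,a)\ge 0$ for all $(i,a)\in K$ and $j\ne i$, and $\sum_{j\in S}q(j|i,a)=0$ for all $(i,a)\in K$. The cost rate $c(i,a)$ is real-valued (of arbitrary sign) and measurable in $a\in A(i)$ for each $i\in S$. Policies. $F$ denotes the set of deterministic stationary policies, identified with functions $f$ on $S$ with $f(i)\in A(i)$ for all $i\in S$. Write $q(j|i,f):=q(j|i,f(i))$ and $c(i,f):=c(i,f(i))$. Process. For $f\in F$ and $i\in S$, $P_i^f$ is the law (with expectation $E_i^f$) under which the right-continuous state process $\{\xi_t,t\ge 0\}$ is the continuous-time Markov chain on $S$ with initial state $\xi_0=i$ and transition rates $q(\cdot|\cdot,f)$: in state $k$ it stays for an exponentially distributed time with tail function $e^{q(k|k,f)t}$ and then jumps to $j\ne k$ with probability $-q(j|k,f)/q(k|k,f)$ (with the convention $0/0:=0$). $T_1$ denotes the first jump time. First passage quantities. Fix $\lambda>0$ and $z\in S$. Set $\tau_z:=\inf\{t\ge T_1:\xi_t=z\}$, with $\inf\emptyset:=\infty$. For $g\in\mathbb{R}$, $i\in S$, $f\in F$, $$h_{g}(i,f):=\frac{1}{\lambda}\ln E_i^f\Big[e^{\lambda\int_0^{\tau_z}(c(\xi_t,f)-g)\,dt}\Big],\qquad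 h_g^*(i):=\inf_{f\in F}h_g(i,f),$$ which may take extended-real values (with $\ln\infty=\infty$, $e^{\infty}=\infty$, $\ln 0=-\infty$, $e^{-\infty}=0$). Set $$G:=\{g\in\mathbb{R}\,|\,h_g^*(z)\le 0\},\qquad \overline{g}:=\inf G.$$ For $g\in\mathbb{R}$ and $(i,a)\in K$, $Q(i,a,g):=\int_0^\infty e^{\lambda(c(i,a)-g)s+q(i|i,a)s}\,ds$ (which may equal $+\infty$), and $Q(i,f,g):=Q(i,f(i),g)$. The convention $0\cdot\infty:=0$ is used.
   Formalization: S is assumed to have at least two states (for S={z}, with g=c(z,f), equation (b) would read 1=0), and each A(i) is assumed nonempty (otherwise F is empty and (a) fails). *)

(* Defs.v *)
From HB Require Import structures.
From mathcomp Require Import all_boot all_order all_algebra.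
From mathcomp Require Import all_classical all_reals all_analysis.

Set Implicit Arguments.
Unset Strict Implicit.
Unset Printing Implicit Defensive.

Import Order.TTheory GRing.Theory Num.Theory.
Import numFieldNormedType.Exports.

Local Open Scope classical_set_scope.
Local Open Scope ring_scope.
Local Open Scope ereal_scope.

Definition polish (R : realType) (X : completePseudoMetricType R) : Prop :=
  hausdorff_space X /\ exists2 D : set X, countable D & dense D.

Definition borel (X : topologicalType) (B : set X) : Prop :=
  <<s @open X >> B.

Definition borel_fun_on (R : realType) (X : completePseudoMetricType R)
    (D : set X) (u : X -> R) : Prop :=
  measurable_fun (T := g_sigma_algebraType (@open X)) D u.

(* A Borel space is a Borel subset of a Polish space: the action space is the
   Borel set [action] of the ambient space X.  [rate j i a] is q(j|i,a); rates
   and costs are only constrained on admissible actions. *)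
Record ctmdm (R : realType) (S : finType) (X : completePseudoMetricType R) :=
  Ctmdm {
    action : set X;
    adm : S -> set X;
    rate : S -> S -> X -> R;
    cost : S -> X -> R;
    action_borel : borel action;
    adm_action : forall i, adm i `<=` action;
    adm_borel : forall i, borel (adm i);
    adm_neq0 : forall i, adm i !=set0;
    rate_meas : forall i j, borel_fun_on (adm i) (rate j i);
    rate_ge0 : forall i j a, adm i a -> j != i -> (0 <= rate j i a)%R;
    rate_sum0 : forall i a, adm i a -> (\sum_(j : S) rate j i a = 0)%R;
    cost_meas : forall i, borel_fun_on (adm i) (cost i) }.

Definition policies (R : realType) (S : finType)
    (X : completePseudoMetricType R) (M : ctmdm S X) : set (S -> X) :=
  [set f | forall i, adm M i (f i)].

Definition rate_of (R : realType) (S : finType)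
    (X : completePseudoMetricType R) (M : ctmdm S X) (f : S -> X)
    (j i : S) : R := rate M j i (f i).

(* The existence of distinct j_1 = i, j_2, ..., j_m with
   q(j_2|j_1) ... q(j|j_m) > 0; here s = j_2, ..., j_m. *)
Definition irreducible_rates (R : realType) (S : finType) (q : S -> S -> R) :=
  forall i j : S, i != j -> exists s : seq S, uniq (i :: s) /\
    (0 < \prod_(p <- zip (i :: s) (rcons s j)) q p.2 p.1)%R.

Section process.
Context (R : realType) (S : finType) (d : measure_display)
  (Omega : measurableType d) (xi : R -> Omega -> S).

Definition right_continuous_process : Prop :=
  (forall (t : R) (j : S), (0 <= t)%R -> measurable [set w | xi t w = j]) /\
  (forall (w : Omega) (t : R), (0 <= t)%R ->
     \forall s \near (t^'+)%R, xi s w = xi t w).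

(* T_0 = 0 and T_{n+1} = inf {t >= T_n | xi_t <> xi_{T_n}}, inf of the empty
   set being +oo. *)
Fixpoint jump_time (n : nat) (w : Omega) : \bar R :=
  if n is m.+1 then
    ereal_inf [set t%:E | t in [set t : R |
      jump_time m w <= t%:E /\ xi t w <> xi (fine (jump_time m w)) w]]
  else 0.

(* Division by zero yields 0, which is the convention 0/0 := 0. *)
Definition jump_prob (q : S -> S -> R) (k j : S) : R :=
  if j == k then 0%R else (- q j k / q k k)%R.

(* Joint law of the visited states and of the sojourn times: starting from i,
   a visit to k lasts an exponential time with tail exp(q(k|k)t), after which
   the chain jumps according to [jump_prob q k], independently of the past. *)
Definition is_ctmc (q : S -> S -> R) (i : S) (mu : probability Omega R) :=
  forall (n : nat) (k : nat -> S) (t : nat -> R), (forall m, 0 <= t m)%R ->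
    mu [set w | forall m, (m <= n)%N ->
      [/\ jump_time m w < +oo,
          xi (fine (jump_time m w)) w = k m &
          jump_time m w + (t m)%:E < jump_time m.+1 w]]
    = ((k 0%N == i)%:R * \prod_(m < n.+1) expR (q (k m) (k m) * t m)
        * \prod_(m < n) jump_prob q (k m) (k m.+1))%R%:E.

Definition tau (z : S) (w : Omega) : \bar R :=
  ereal_inf [set t%:E | t in [set t : R | jump_time 1 w <= t%:E /\ xi t w = z]].

End process.

Section first_passage.
Context (R : realType) (S : finType) (X : completePseudoMetricType R)
  (M : ctmdm S X) (lambda : R) (d : measure_display)
  (Omega : measurableType d) (xi : R -> Omega -> S)
  (P : (S -> X) -> S -> probability Omega R) (z : S).

Definition passage_cost (g : R) (f : S -> X) (w : Omega) : \bar R :=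
  \int[@lebesgue_measure R]_(t in [set t : R | (0 <= t)%R /\ t%:E < tau xi z w])
    (cost M (xi t w) (f (xi t w)) - g)%:E.

Definition h (g : R) (i : S) (f : S -> X) : \bar R :=
  (lambda^-1)%:E *
    lne (\int[P f i]_w expeR (lambda%:E * passage_cost g f w)).

Definition hstar (g : R) (i : S) : \bar R :=
  ereal_inf [set h g i f | f in policies M].

Definition G : set R := [set g | hstar g z <= 0].

Definition gbar : \bar R := ereal_inf [set g%:E | g in G].

Definition Q (i : S) (a : X) (g : R) : \bar R :=
  \int[@lebesgue_measure R]_(s in `[0%R, +oo[)
    (expR (lambda * (cost M i a - g) * s + rate M i i a * s))%:E.

(* Right-hand side of the optimality equations; u stands for e^(lambda h). *)
Definition bellman (g : R) (u : S -> \bar R) (i : S) (a : X) : \bar R :=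
  if i == z then Q z a g * \sum_(j | j != z) u j * (rate M j z a)%:E
  else Q i a g * ((rate M z i a)%:E +
         \sum_(j | (j != i) && (j != z)) u j * (rate M j i a)%:E).

Definition exp_h (g : R) (f : S -> X) (j : S) : \bar R :=
  expeR (lambda%:E * h g j f).

Definition exp_hstar (g : R) (j : S) : \bar R :=
  expeR (lambda%:E * hstar g j).

Definition bellman_inf (g : R) (i : S) : \bar R :=
  ereal_inf [set bellman g (exp_hstar g) i a | a in adm M i].

Definition attains_min (g : R) (f : S -> X) : Prop :=
  forall i, bellman g (exp_hstar g) i (f i) = bellman_inf g i.

End first_passage.

(* Main.v *)
Require Import Defs.
From HB Require Import structures.
From mathcomp Require Import all_boot all_order all_algebra.
From mathcomp Require Import all_classical all_reals all_analysis.
From mathcomp Require Import measurable_realfun.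
From mathcomp Require Import ring lra.

Set Implicit Arguments.
Unset Strict Implicit.
Unset Printing Implicit Defensive.

Import Order.TTheory GRing.Theory Num.Theory.
Import numFieldNormedType.Exports.

Local Open Scope classical_set_scope.
Local Open Scope ring_scope.
Local Open Scope ereal_scope.

(* Along a path i = k_0, k_1, ..., k_n = z avoiding z at the times 1, ..., n-1, the
   exponential passage cost is a product of functions of independent exponential
   sojourn times, so its expectation is the product of the weights
   w(k, j) = Q(k, f, g) q(j|k, f).  The embedded chain hits z almost surely;
   summing over the paths shows that e^(lambda h_g(., f)) is the least nonnegative
   fixed point of u |-> w(., z) + sum_(j != z) w(., j) u(j), and even lies below
   every nonnegative supersolution.  The optimality equations follow for every g:
   a policy attaining the minima, which exists by lower semicontinuity and
   compactness, has e^(lambda h*_g) as a supersolution.  Finiteness for g in G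
   spreads from z along irreducibility.  At gbar, the supremum of e^(lambda h*_g)
   over g > gbar is a supersolution for some policy, so gbar is in G; and if
   h*_gbar(z) < 0, a strict supersolution near e^(lambda h_gbar) would remain a
   supersolution for some g < gbar. *)

(** * Least fixed points of nonnegative matrices *)

(** Three features shape the proof. First, [Q] may be +oo, so the identities live in [0, +oo] with 0
    * oo = 0. The product is not continuous at (0, +oo); for nonnegative functions only lower limits
    of sums and products survive. Hence minimisers, and the policy at gbar, come from nested
    sublevel sets of semicontinuous functions, and an infinite expectation along a path is obtained
    by letting lowered exponents tend to a critical value. Second, the process is known only through
    joint tails of sojourn times on path events, so the expectation along a path is recovered by
    treating one sojourn time after the other. Third, irreducibility is used as an induction
    principle: a set of states that contains some state and is closed under predecessors is
    everything. Different choices of the set give negative diagonal rates, almost sure hitting,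
    positivity, finiteness and strict supersolutions. At gbar the function e^(lambda h) solves its
    equation with equality, which leaves no room for a smaller g; the strict supersolution supplies
    slack at all of the finitely many states at once. *)

Lemma nneseries_mull (R : realType) (f : nat -> \bar R) (x : \bar R) :
  0 <= x -> (forall n, 0 <= f n) ->
  \sum_(n <oo) (x * f n) = x * \sum_(n <oo) f n.
Proof.
move=> x0 f0; case: x x0 => [x _|_|//]; first by rewrite nneseriesZl.
(* For x = +oo, both sides are 0 if f vanishes identically and +oo otherwise. *)
have [f_eq0|] := pselect (forall n, f n = 0).
  rewrite [in RHS]eseries0 ?mule0; last by move=> n _ _; exact: f_eq0.
  by apply: eseries0 => n _ _; rewrite f_eq0 mule0.
move=> /existsNP[n /eqP fn_neq0].
have fn_gt0 : 0 < f n by rewrite lt0e fn_neq0 f0.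
rewrite gt0_mulye; last first.
  by apply: (lt_le_trans fn_gt0);
    rewrite (@nneseriesD1 _ _ n xpredT)// leeDl// nneseries_ge0.
apply/eqP; rewrite -leye_eq (@nneseriesD1 _ _ n xpredT)//=; last by move=> k _;
  rewrite mule_ge0.
by rewrite gt0_mulye// leeDl// nneseries_ge0// => k _ _; rewrite mule_ge0.
Qed.

Section hitting.
Context (R : realType) (S : finType) (z : S).
Implicit Types (w : S -> S -> \bar R) (u : S -> \bar R).

(** Arrival at z counts 1 and [u z] never enters on the right, so the value at z belongs to the
    return to z, as [tau] only looks from the first jump on. *)
Definition hit_step w u i := w i z + \sum_(j | j != z) w i j * u j.

(** The total weight of the paths whose first visit to z after time 0 happens at step n + 1. *)
Fixpoint hit_at w n i :=
  if n is m.+1 then \sum_(j | j != z) w i j * hit_at w m j else w i z.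

Definition hit w i := \sum_(n <oo) hit_at w n i.

Lemma hit_at_ge0 w n i : (forall i j, 0 <= w i j) -> 0 <= hit_at w n i.
Proof.
by move=> w0; elim: n i => [|n IH] i //=; rewrite sume_ge0// => j _;
  rewrite mule_ge0.
Qed.

Lemma hit_ge0 w i : (forall i j, 0 <= w i j) -> 0 <= hit w i.
Proof. by move=> w0; apply: nneseries_ge0 => n _ _; exact: hit_at_ge0. Qed.

Lemma hit_stepE w i : (forall i j, 0 <= w i j) ->
  hit w i = hit_step w (hit w) i.
Proof.
move=> w0; have h0 n j : 0 <= hit_at w n j by exact: hit_at_ge0.
rewrite /hit nneseries_recl//; congr (_ + _).
rewrite -nneseries_addn//; under eq_eseriesr do rewrite addn1 /=.
rewrite nneseries_sum; last by move=> j n _; rewrite mule_ge0.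
by apply: eq_bigr => j _; rewrite nneseries_mull.
Qed.

Lemma le_hit_step w w' u u' i :
  (forall i j, 0 <= w i j) -> (forall j, 0 <= u j) ->
  (forall i j, w i j <= w' i j) -> (forall j, u j <= u' j) ->
  hit_step w u i <= hit_step w' u' i.
Proof.
by move=> w0 u0 ww' uu'; apply: leeD => //; apply: lee_sum => j _;
  exact: lee_pmul.
Qed.

(** By induction each partial sum of [hit] stays below u: the partial sum with one more term is
    [hit_step] of the previous one. *)
Lemma hit_le w u : (forall i j, 0 <= w i j) -> (forall j, 0 <= u j) ->
  (forall i, hit_step w u i <= u i) -> forall i, hit w i <= u i.
Proof.
move=> w0 u0 wu i; have h0 n j : 0 <= hit_at w n j by exact: hit_at_ge0.
apply: lime_le; first by apply: is_cvg_nneseries => n _ _.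
apply: nearW => n; rewrite /= big_mkord.
elim: n i => [|n IH] i; first by rewrite big_ord0.
rewrite big_ord_recl; apply: le_trans (wu i).
apply: leeD => //=; rewrite exchange_big/=; apply: lee_sum => j _.
rewrite -ge0_sume_distrr//; exact: lee_wpmul2l.
Qed.

Lemma le_hit w w' : (forall i j, 0 <= w i j) -> (forall i j, w i j <= w' i j) ->
  forall i, hit w i <= hit w' i.
Proof.
move=> w0 ww'; have w'0 i j : 0 <= w' i j by exact: le_trans (ww' i j).
apply: hit_le => // [i|i]; first exact: hit_ge0.
by rewrite [leRHS]hit_stepE//; apply: le_hit_step => // j; exact: hit_ge0.
Qed.

Lemma hit_gt0 w : (forall i j, 0 <= w i j) ->
  (forall D : S -> Prop, D z -> (forall i j, D j -> 0 < w i j -> D i) ->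
    forall i, D i) ->
  (forall i, exists j, 0 < w i j) ->
  forall i, 0 < hit w i.
Proof.
move=> w0 reach out.
have pos i j : 0 < w i j -> j = z \/ 0 < hit w j -> 0 < hit w i.
  rewrite (hit_stepE i)// => wij; have [jz|jz] := eqVneq j z.
    move: wij; rewrite jz => wij _;
      rewrite (lt_le_trans wij)// /hit_step leeDl// sume_ge0// => k _.
    by rewrite mule_ge0// hit_ge0.
  case=> [/eqP|hj]; first by rewrite (negbTE jz).
  apply: (lt_le_trans (mule_gt0 wij hj)).
  rewrite /hit_step (bigD1 j)//= addeCA leeDl// adde_ge0// sume_ge0// => k _.
  by rewrite mule_ge0// hit_ge0.
(* The alternative i = z starts the backward closure; positivity at z itself then comes from a
   successor of z. *)
have D_all : forall i, i = z \/ 0 < hit w i.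
  by apply: reach; [left|move=> i j Dj wij; right; exact: pos Dj].
by move=> i; have [j wij] := out i; exact: pos (D_all j).
Qed.

(* At a minimum of the hitting probability, all the successors are minima too. *)
Lemma hit_eq1 w : (forall i j, 0 <= w i j) -> (forall i, \sum_j w i j = 1) ->
  (forall D : S -> Prop, D z -> (forall i j, D j -> 0 < w i j -> D i) ->
    forall i, D i) ->
  forall i, hit w i = 1.
Proof.
move=> w0 w1 reach.
have h_le1 i : hit w i <= 1.
  apply: (@hit_le _ (fun=> 1)) => // {}i; rewrite /hit_step.
  by under eq_bigr do rewrite mule1; rewrite -(w1 i) [leRHS](bigD1 z).
have h_ge0 i := hit_ge0 i w0.
have w_fin i j : w i j \is a fin_num.
  rewrite ge0_fin_numE// (@le_lt_trans _ _ 1) ?ltry//.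
  by rewrite -(w1 i) (bigD1 j)//= leeDl// sume_ge0.
have h_fin i : hit w i \is a fin_num.
  by rewrite ge0_fin_numE// (le_lt_trans (h_le1 i)) ?ltry.
pose v i := fine (hit w i); have vE i : hit w i = (v i)%:E by rewrite fineK.
pose i0 := [arg min_(i < z) v i]%O.
have v_min i : (v i0 <= v i)%R.
  by rewrite /i0; case: Order.TotalTheory.arg_minP => // k _ /(_ i); exact.
suff v1 : (1 <= v i0)%R.
  by move=> i; apply/eqP; rewrite eq_le h_le1 vE lee_fin (le_trans v1).
rewrite leNgt; apply/negP => v_lt1.
pose a i j := fine (w i j); have aE i j : w i j = (a i j)%:E by rewrite fineK.
have a0 i j : (0 <= a i j)%R by rewrite -lee_fin -aE.
have a1 i : (\sum_j a i j = 1)%R.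
  by apply: EFin_inj; rewrite -sumEFin -(w1 i); apply: eq_bigr => j _;
    rewrite aE.
(* The value seen by a step that lands on j: landing on z is already a success. With it, v is the
   average of v' under the row of w. *)
pose v' j := if j == z then 1%R else v j.
have v'_min j : (v i0 <= v' j)%R by rewrite /v'; case: eqP => // _; exact: ltW.
have vS i : (v i = \sum_j a i j * v' j)%R.
  apply: EFin_inj; rewrite -vE hit_stepE// /hit_step [in RHS](bigD1 z)//= EFinD.
  rewrite {1}/v' eqxx mulr1 aE.
  by rewrite -sumEFin; congr (_ + _); apply: eq_bigr => j jz;
    rewrite /v' (negbTE jz) aE vE.
have strict i j : (0 < a i j)%R -> (v i0 < v' j)%R -> (v i0 < v i)%R.
  move=> aij vj; rewrite (vS i) -subr_gt0.
  have -> : (\sum_k a i k * v' k - v i0 = \sum_k a i k * (v' k - v i0))%R.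
    rewrite -[in LHS](mul1r (v i0)) -(a1 i) mulr_suml -sumrB.
    by apply: eq_bigr => k _; rewrite mulrBr.
  rewrite (bigD1 j)//= ltr_pwDl//; first by rewrite mulr_gt0// subr_gt0.
  by apply: sumr_ge0 => k _; rewrite mulr_ge0// subr_ge0.
(* The states above the minimum contain z, as the minimum is assumed to be below 1, and are closed
   under predecessors by [strict]. A successor of i0 then puts v i0 strictly above itself. *)
have D_all : forall i, (v i0 < v' i)%R.
  apply: reach; first by rewrite /v' eqxx.
  move=> i j vj; rewrite aE lte_fin => /strict/(_ vj).
  by rewrite /v'; case: eqP.
have /existsP[j aij] : [exists j, (0 < a i0 j)%R].
  apply/contraT; rewrite negb_exists => /forallP an.
  have := a1 i0; rewrite big1; first by move/esym/eqP; rewrite oner_eq0.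
  by move=> j _; apply/eqP; rewrite eq_le a0 leNgt an.
by have := strict _ _ aij (D_all j); rewrite ltxx.
Qed.

End hitting.

(** * Jump times *)

Arguments jump_time : simpl never.

Lemma bigcapT_measurable_rat d (T : measurableType d) (F : rat -> set T) :
  (forall q, measurable (F q)) -> measurable (\bigcap_q F q).
Proof.
move=> mF; rewrite -[X in measurable X]setCK setC_bigcap; apply: measurableC.
by apply: bigcupT_measurable_rat => q; exact: measurableC.
Qed.

Section jumps.
Context (R : realType) (S : finType) (d : measure_display)
  (Omega : measurableType d) (xi : R -> Omega -> S).
Hypothesis xi_rc : right_continuous_process xi.

Local Notation T := (jump_time xi).

Definition visited n w := xi (fine (T n w)) w.

Lemma xi_right_const w (t : R) : (0 <= t)%R ->
  exists2 e : R, (0 < e)%R & forall s, (t <= s < t + e)%R -> xi s w = xi t w.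
Proof.
move=> t0; have [e /= e0 he] := xi_rc.2 w t t0.
exists e => // s /andP[ts se]; have [->//|st] := eqVneq s t.
apply: he; last by rewrite lt_neqAle eq_sym st.
by rewrite /= distrC ger0_norm ?subr_ge0// ltrBlDl.
Qed.

Lemma le_jump_timeS n w : T n w <= T n.+1 w.
Proof. by apply: le_ereal_inf_tmp => _ [t [+ _] <-]. Qed.

Lemma le_jump_time m n w : (m <= n)%N -> T m w <= T n w.
Proof.
elim: n => [|n IH]; first by rewrite leqn0 => /eqP ->.
by rewrite leq_eqVlt ltnS => /predU1P[->//|/IH] /le_trans; apply;
  exact: le_jump_timeS.
Qed.

Lemma jump_time_ge0 n w : 0 <= T n w.
Proof. exact: (@le_jump_time 0). Qed.

Lemma fineK_jump_time n w : T n w < +oo -> (fine (T n w))%:E = T n w.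
Proof. by move=> ?; rewrite fineK// ge0_fin_numE// jump_time_ge0. Qed.

Lemma lt_jump_timeS n w : T n w < +oo -> T n w < T n.+1 w.
Proof.
move=> Tn; have t0 := jump_time_ge0 n w.
have [e e0 he] := @xi_right_const w (fine (T n w)) (fine_ge0 t0).
apply: (@lt_le_trans _ _ (fine (T n w) + e)%:E).
  by rewrite -[ltLHS]fineK_jump_time// lte_fin ltrDl.
apply: le_ereal_inf_tmp => _ [t [Tt xit] <-]; rewrite lee_fin leNgt.
apply/negP => te; apply: xit; apply: he; rewrite te andbT -lee_fin.
by rewrite fineK_jump_time.
Qed.

Lemma xi_between n w s :
  T n w <= s%:E -> s%:E < T n.+1 w -> xi s w = visited n w.
Proof.
move=> Tns; apply: contraPP => xis.
by apply/negP; rewrite -leNgt; apply: ereal_inf_lbound; exists s.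
Qed.

Lemma lt_ratr_right (a b : R) : (a < b)%R -> exists q : rat, (a < ratr q < b)%R.
Proof. by move=> /rat_in_itvoo[q]; rewrite in_itv/=; exists q. Qed.

Lemma measurable_xi t j : (0 <= t)%R -> measurable [set w | xi t w = j].
Proof. exact: xi_rc.1. Qed.

(** By right continuity, the state at time U is j iff, for some n, the state is j at all rational
    times in ]U, U + 1/(n+1)[; this involves countably many events. The maximum with 0 keeps the
    rational times in the range where [xi] is controlled. *)
Lemma measurable_xi_at (U : Omega -> \bar R) j : measurable_fun setT U ->
  (forall w, 0 <= U w) ->
  measurable [set w | U w < +oo /\ xi (fine (U w)) w = j].
Proof.
move=> mU U0.
have mle a : measurable [set w | U w <= a]
  by rewrite -[X in measurable X]setTI; exact: emeasurable_fun_infty_c.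
have mge a : measurable [set w | a <= U w]
  by rewrite -[X in measurable X]setTI; exact: emeasurable_fun_c_infty.
have mlt a : measurable [set w | U w < a] by rewrite -[X in measurable X]setTI;
  exact: emeasurable_fun_infty_o.
have -> : [set w | U w < +oo /\ xi (fine (U w)) w = j] =
    [set w | U w < +oo] `&` \bigcup_n \bigcap_(q : rat)
     ([set w | (ratr q)%:E <= U w] `|`
      [set w | U w <= (ratr q - n.+1%:R^-1)%:E] `|`
      [set w | xi (Num.max 0%R (ratr q)) w = j]).
  apply/seteqP; split => w /= [Uw h]; split => //;
    (have UE : U w = (fine (U w))%:E by rewrite fineK// ge0_fin_numE);
    have := fine_ge0 (U0 w); move: UE h; set u := fine (U w) => UE h u0;
    have [e e0 he] := xi_right_const w u0.
    have [n _ /(_ n (leqnn n)) /= ne] := near_infty_natSinv_lt (PosNum e0).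
    exists n => // q _ /=; rewrite UE !lee_fin.
    have [qU|Uq] := leP (ratr q) u; first by left; left.
    have [qe|eq] := leP u (ratr q - n.+1%:R^-1)%R; first by left; right.
    right; rewrite -h (max_idPr (ltW (le_lt_trans u0 Uq))).
    apply: he; apply/andP; split; [exact: ltW|]. by move: eq ne;
      set x := (_^-1)%R; lra.
  have [n _ hn] := h; have n0 : (0 < n.+1%:R^-1 :> R)%R by rewrite invr_gt0.
  (* A rational time just after U, inside both the window given by n and the interval on which the
     trajectory is constant. *)
  have [q /andP[uq qe]] : exists q : rat,
    (u < ratr q < u + Num.min e n.+1%:R^-1)%R.
    by apply: lt_ratr_right; rewrite ltrDl lt_min e0.
  have := hn q Logic.I; rewrite /= UE !lee_fin; rewrite -ltrBlDl lt_min in qe.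
  case/andP: qe => qe qn [[h1|h1]|]; [by move: uq; rewrite ltNge h1| |].
    by move: qn; rewrite ltNge lerBrDl -lerBrDr h1.
  by rewrite (max_idPr (ltW (le_lt_trans u0 uq))) => <-;
    rewrite he// (ltW uq)/=; lra.
apply: measurableI => //; apply: bigcup_measurable => n _.
apply: bigcapT_measurable_rat => q; apply: measurableU;
  first exact: measurableU.
by apply: measurable_xi; rewrite le_max lexx.
Qed.

(** By right continuity, T (n+1) < a iff some rational q < a with T n <= q sees a state different
    from the one at T n: a new state persists for a while, so a rational time detects it. *)
Lemma measurable_jump_time n : measurable_fun setT (T n).
Proof.
elim: n => [|n IH]; first exact: measurable_cst.
apply: (measurability _ (ErealGenCInfty.measurableE R)) => //.
move=> /= _ [_ [a ->]] <-; apply: measurableI => //.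
have -> : T n.+1 @^-1` `[a%:E, +oo[%classic =
  ~` (\bigcup_(q : rat) \bigcup_(j in [set: S])
       ([set w | T n w <= (ratr q)%:E] `&` [set w | (ratr q < a)%R] `&`
        [set w | T n w < +oo /\ xi (fine (T n w)) w = j] `&`
        [set w | xi (Num.max 0%R (ratr q)) w <> j])).
  apply/seteqP; split => w /=.
    rewrite in_itv/= andbT => aT [q _ [j _ [[[Tq qa] [_ xij]]]]] /=.
    have q0 : (0 <= ratr q :> R)%R
      by rewrite -lee_fin (le_trans _ Tq)// jump_time_ge0.
    rewrite (max_idPr q0) -xij => xiq.
    have : T n.+1 w <= (ratr q)%:E by apply: ereal_inf_lbound; exists (ratr q).
    by move=> /(le_trans aT); rewrite lee_fin leNgt qa.
  move=> h; rewrite in_itv/= andbT leNgt; apply/negP => Ta; apply: h.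
  have [_ [t [Tt xit] <-]] := ereal_inf_lt Ta; rewrite lte_fin => ta.
  have t0 : (0 <= t)%R by rewrite -lee_fin (le_trans _ Tt)// jump_time_ge0.
  have [e e0 he] := xi_right_const w t0.
  have [q /andP[tq]] : exists q : rat, (t < ratr q < Num.min a (t + e))%R.
    by apply: lt_ratr_right; rewrite lt_min ta ltrDl.
  rewrite lt_min => /andP[qa qe].
  exists q => //; exists (visited n w) => //=; split; first split;
    first split => //=.
  - by rewrite (le_trans Tt)// lee_fin ltW.
  - by split => //; rewrite (le_lt_trans Tt) ?ltry.
  - by rewrite (max_idPr (ltW (le_lt_trans t0 tq))) he// qe ltW.
apply: measurableC; apply: bigcupT_measurable_rat => q.
apply: fin_bigcup_measurable => // j _.
apply: measurableI; last first.
  apply: (@measurableC _ _ [set w | xi (Num.max 0%R (ratr q)) w = j]).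
  by apply: measurable_xi; rewrite le_max lexx.
apply: measurableI; last by apply: measurable_xi_at => // w;
  exact: jump_time_ge0.
apply: measurableI; first by rewrite -[X in measurable X]setTI;
  exact: emeasurable_fun_infty_c.
have [qa|qa] := ltP (ratr q) a.
  by rewrite (_ : [set _ | _] = setT)//; apply/seteqP; split.
by rewrite (_ : [set _ | _] = set0)//; apply/seteqP; split.
Qed.

Lemma measurable_visited n j :
  measurable [set w | T n w < +oo /\ visited n w = j].
Proof. by apply: measurable_xi_at;
  [exact: measurable_jump_time|exact: jump_time_ge0]. Qed.

End jumps.

(** * Passage time and passage cost along a prescribed path *)

Section passage.
Context (R : realType) (S : finType) (d : measure_display)
  (Omega : measurableType d) (xi : R -> Omega -> S).
Hypothesis xi_rc : right_continuous_process xi.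

Local Notation T := (jump_time xi).

Definition sojourn m w : R := (fine (T m.+1 w) - fine (T m w))%R.

Definition on_path (k : nat -> S) n w :=
  forall m, (m <= n)%N -> T m w < +oo /\ visited xi m w = k m.

Lemma on_pathS k n w : on_path k n.+1 w -> on_path k n w.
Proof. by move=> kw m mn; apply: kw; rewrite (leq_trans mn). Qed.

Lemma measurable_sojourn m : measurable_fun setT (sojourn m).
Proof.
apply: measurable_funB; apply: measurableT_comp => //;
  exact: measurable_jump_time.
Qed.

Lemma measurable_on_path k n : measurable [set w | on_path k n w].
Proof.
have -> : [set w | on_path k n w] =
    \bigcap_(m in [set m | (m <= n)%N]) [set w | T m w < +oo /\ visited xi m w = k m].
  by apply/seteqP; split.
apply: bigcap_measurable; first by exists 0%N.
by move=> m _; exact: measurable_visited.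
Qed.

Lemma jump_interval n w (t : R) : T 1 w <= t%:E -> t%:E < T n w ->
  exists m, [/\ (0 < m < n)%N, T m w <= t%:E & t%:E < T m.+1 w].
Proof.
move=> t1; elim: n => [|n IH] tn.
  by have := le_lt_trans (le_trans (jump_time_ge0 xi 1 w) t1) tn;
    rewrite /= ltxx.
have [Tt|tT] := leP (T n w) t%:E.
  case: n {IH} tn Tt => [|n] tn Tt; first by have := le_lt_trans t1 tn;
    rewrite ltxx.
  by exists n.+1; split => //; rewrite ltnSn.
by have [m [/andP[m0 mn] ? ?]] := IH tT; exists m; split => //; rewrite m0 ltnW.
Qed.

(** A time in [T 1, T n[ lies in a sojourn of index strictly between 0 and n, where the state
    differs from z. The initial sojourn is left out, so the path may start at z. *)
Lemma tau_on_path k n z w : (0 < n)%N -> on_path k n w ->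
  (forall m, (0 < m < n)%N -> k m <> z) -> k n = z -> tau xi z w = T n w.
Proof.
move=> n0 kw kz kn; have [Tn vn] := kw n (leqnn n).
apply/eqP; rewrite eq_le; apply/andP; split.
  apply: ereal_inf_lbound; exists (fine (T n w)); last exact: fineK_jump_time.
  by split; rewrite ?fineK_jump_time ?le_jump_time// -kn -vn.
apply: le_ereal_inf_tmp => _ [t [t1 xit] <-]; rewrite leNgt; apply/negP => tn.
have [m [m0n Tm tm]] := jump_interval t1 tn.
apply: (kz m m0n); have /andP[_ mn] := m0n.
by have [_ <-] := kw m (ltnW mn); rewrite -xit; exact/esym/xi_between.
Qed.

Lemma passage_intervalE n w : T n w < +oo ->
  [set t : R | (0 <= t)%R /\ t%:E < T n w] = `[0%R, fine (T n w)[%classic.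
Proof.
move=> Tn; apply/seteqP; split => t /=;
  rewrite in_itv/= -lte_fin fineK_jump_time//.
  by case=> -> ->.
by move=> /andP[].
Qed.

Lemma le_fine_jump_time m n w : (m <= n)%N -> T n w < +oo ->
  (fine (T m w) <= fine (T n w))%R.
Proof.
move=> mn Tn; rewrite -lee_fin !fineK_jump_time ?le_jump_time//.
by apply: le_lt_trans Tn; exact: le_jump_time.
Qed.

(** The integrand may have any sign, so splitting the integral at T n requires its measurability,
    which is therefore carried through the same induction. *)
Lemma passage_integral (u : S -> R) k n w : on_path k n w ->
  measurable_fun [set t : R | (0 <= t)%R /\ t%:E < T n w] (fun t => (u (xi t w))%:E) /\
  \int[@lebesgue_measure R]_(t in [set t : R | (0 <= t)%R /\ t%:E < T n w])
    (u (xi t w))%:E = (\sum_(m < n) u (k m) * sojourn m w)%:E.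
Proof.
elim: n => [|n IH] kw.
  rewrite passage_intervalE ?ltry//= set_itv_ge ?bnd_simp ?ltxx//.
  by rewrite integral_set0 big_ord0; split => //; exact: measurable_fun_set0.
have [Tn vn] := kw n (leqnSn n); have [Tn1 _] := kw n.+1 (leqnn _).
have [mI intI] := IH (on_pathS kw).
have TT := le_fine_jump_time (leqnSn n) Tn1.
have T0 := fine_ge0 (jump_time_ge0 xi n w).
have J t : t \in `[fine (T n w), fine (T n.+1 w)[ -> u (xi t w) = u (k n).
  rewrite in_itv/= -lte_fin -lee_fin !fineK_jump_time// => /andP[? ?].
  by rewrite -vn; congr u; exact: xi_between.
have splitE : [set t : R | (0 <= t)%R /\ t%:E < T n.+1 w] =
    [set t : R | (0 <= t)%R /\ t%:E < T n w] `|` `[fine (T n w), fine (T n.+1 w)[%classic.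
  by rewrite !passage_intervalE//; apply: itv_bndbnd_setU; rewrite bnd_simp.
have mI2 : measurable_fun `[fine (T n w), fine (T n.+1 w)[ (fun t => (u (xi t w))%:E).
  apply: (eq_measurable_fun (cst (u (k n))%:E)) => [t|];
    last exact: measurable_cst.
  by rewrite inE/= => /J ->.
have mD1 : measurable [set t : R | (0 <= t)%R /\ t%:E < T n w]
  by rewrite passage_intervalE.
have mU : measurable_fun [set t : R | (0 <= t)%R /\ t%:E < T n.+1 w] (fun t => (u (xi t w))%:E).
  by rewrite splitE; apply/measurable_funU.
split => //; rewrite splitE integral_setU//; last 2 first.
- by rewrite -splitE.
- rewrite passage_intervalE// disj_set2E; apply/eqP/seteqP; split => // t [] /=.
  by rewrite !in_itv/= => /andP[_ t1] /andP[t2 _]; have := le_lt_trans t2 t1;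
    rewrite ltxx.
rewrite intI big_ord_recr/= EFinD; congr (_ + _).
under eq_integral do [].
rewrite (eq_integral (cst (u (k n))%:E)); last by move=> t;
  rewrite inE/= => /J ->.
rewrite integral_cst//= lebesgue_measure_itv/= lte_fin.
case: ltP => [_|TT']; first by rewrite EFinM.
by rewrite /sojourn (le_anti (introT andP (conj TT TT'))) subrr mulr0 mule0.
Qed.

End passage.

(** * The law of the sojourn times *)

Section density.
Import HBNNSimple.
Context d (T : measurableType d) (R : realType) (mu : {measure set T -> \bar R}).

Lemma density_measure (f : T -> R) :
  measurable_fun setT f -> (forall x, (0 <= f x)%R) ->
  exists nu : {measure set T -> \bar R},
    forall A, nu A = \int[mu]_(x in A) (f x)%:E.
Proof.
move=> mf f0; pose nu (A : set T) := \int[mu]_(x in A) (f x)%:E.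
have nu0 : nu set0 = 0 by rewrite /nu integral_set0.
have nu_ge0 A : 0 <= nu A by apply: integral_ge0 => x _; rewrite lee_fin.
have nu_sigma : semi_sigma_additive nu.
  move=> F mF tF mUF; apply: cvg_toP.
    apply: ereal_nondecreasing_is_cvgn => m n mn.
    exact: lee_sum_nneg_natr.
  rewrite /nu ge0_integral_bigcup//=.
  - exact/measurable_EFinP/measurable_funTS.
  - by move=> x _; rewrite lee_fin.
pose nuM := isMeasure.Build _ _ _ nu nu0 nu_ge0 nu_sigma.
by exists (HB.pack nu nuM : {measure set T -> \bar R}).
Qed.

Lemma integral_density (f : T -> R) (nu : {measure set T -> \bar R})
    (g : T -> \bar R) :
  measurable_fun setT f -> (forall x, (0 <= f x)%R) ->
  (forall A, measurable A -> nu A = \int[mu]_(x in A) (f x)%:E) ->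
  measurable_fun setT g -> (forall x, 0 <= g x) ->
  \int[nu]_x g x = \int[mu]_x ((f x)%:E * g x).
Proof.
move=> mf f0 nuE mg g0; pose g_ := nnsfun_approx measurableT mg.
have mfE : measurable_fun setT (EFin \o f) by exact/measurable_EFinP.
have g_cvg x : (g_ n x)%:E @[n --> \oo] --> g x.
  by apply: (@cvg_nnsfun_approx _ _ _ _ measurableT _ mg) => // y _.
have g_nd x m n : (m <= n)%N -> (g_ m x)%:E <= (g_ n x)%:E.
  by move=> mn; rewrite lee_fin; exact/lefP/nd_nnsfun_approx.
transitivity (limn (fun n => \int[nu]_x (g_ n x)%:E)).
  rewrite -monotone_convergence//; last 3 first.
  - by move=> n; exact/measurable_EFinP.
  - by move=> n x _; rewrite lee_fin.
  - by move=> x _ m n mn; exact: g_nd.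
  by apply: eq_integral => x _; apply/esym/cvg_lim.
transitivity (limn (fun n => \int[mu]_x ((f x)%:E * (g_ n x)%:E))); last first.
  rewrite -monotone_convergence//; last 3 first.
  - by move=> n; apply: emeasurable_funM => //; exact/measurable_EFinP.
  - by move=> n x _; rewrite mule_ge0// lee_fin.
  - by move=> x _ m n mn; rewrite lee_wpmul2l ?lee_fin//; exact: g_nd.
  apply: eq_integral => x _; apply/cvg_lim => //.
  by apply: cvgeZl => //; exact: g_cvg.
congr (limn _); apply/funext => n.
rewrite integralT_nnsfun sintegralE.
have mpre y : measurable (g_ n @^-1` [set y]) by exact: measurable_sfunP.
transitivity (\int[mu]_x \sum_(y \in range (g_ n))
    (y%:E * ((f x)%:E * (\1_(g_ n @^-1` [set y]) x)%:E))).
  rewrite ge0_integral_fsum//; last 2 first.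
  - move=> y; apply: emeasurable_funM => //; apply: emeasurable_funM => //.
    exact/measurable_EFinP/measurable_indic.
  - move=> y x _; rewrite muleCA mule_ge0 ?lee_fin//.
    exact: nnfun_muleindic_ge0.
  apply: eq_fsbigr => y /[!inE] -[t _ <-].
  rewrite ge0_integralZl//; last 3 first.
  - by apply: emeasurable_funM => //; exact/measurable_EFinP/measurable_indic.
  - by move=> x _; rewrite mule_ge0 ?lee_fin.
  - by rewrite lee_fin.
  rewrite nuE//; congr (_ * _); rewrite integral_mkcond;
    apply: eq_integral => x _.
  by rewrite patchE indicE; case: ifPn => _; rewrite ?mule1 ?mule0.
apply: eq_integral => x _; rewrite [in RHS]fimfunE -fsumEFin//.
rewrite ge0_mule_fsumr => [|y]; last exact: nnfun_muleindic_ge0.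
by apply: eq_fsbigr => y _; rewrite EFinM muleCA.
Qed.
End density.

Lemma integral_expR_tail (R : realType) (r t : R) : (0 < r)%R ->
  \int[@lebesgue_measure R]_(s in `[t, +oo[) (expR (- r * s))%:E =
  (r^-1 * expR (- r * t))%:E.
Proof.
move=> r0; pose F (s : R) : R := (- (r^-1 * expR (- r * s)))%R.
have cE : continuous (fun s : R => expR (- r * s)).
  by move=> s; apply: continuous_comp;
    [exact: mulrl_continuous|exact: continuous_expR].
have cF : continuous F.
  by move=> s; apply: cvgN; apply: cvgMl_tmp; exact: cE.
have dF (s : R) : is_derive s 1%R F (expR (- r * s)).
  rewrite /F; apply: is_derive_eq; rewrite /GRing.scale/= mulr1 !mulrN opprK.
  by rewrite mulrCA mulVf ?mulr1// gt_eqF.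
rewrite (@ge0_continuous_FTC2y R _ F t 0%R).
- by rewrite /F EFinN oppeK add0e.
- by move=> s _; exact: expR_ge0.
- exact: continuous_subspaceT.
- rewrite /F -oppr0; apply: cvgN; rewrite -(mulr0 r^-1%R); apply: cvgMl_tmp.
  rewrite (_ : (fun x => expR (- r * x)) =
               (fun z => expR (- z)) \o (fun z => r * z))%R; last first.
    by apply: funext => x; rewrite /= mulNr.
  apply: (@cvg_comp _ _ _ _ _ _ (pinfty_nbhs R)); last exact: cvgr_expR.
  exact: gt0_cvgMry.
- by move=> s _; case: (dF s).
- exact/cvg_at_right_filter/cF.
- by move=> s _; rewrite derive1E; case: (dF s).
Qed.

Lemma integral_exponential_gt (R : realType) (r t : R) :
  (0 < r)%R -> (0 <= t)%R ->
  \int[@lebesgue_measure R]_(s in `]t, +oo[) (exponential_pdf r s)%:E =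
  (expR (- r * t))%:E.
Proof.
move=> r0 t0; rewrite integral_itv_obnd_cbnd; last first.
  by apply: measurable_funTS; apply/measurable_EFinP;
    exact: measurable_exponential_pdf.
transitivity (\int[@lebesgue_measure R]_(s in `[t, +oo[) (r%:E * (expR (- r * s))%:E)).
  apply: eq_integral => s; rewrite inE/= in_itv/= andbT => ts.
  by rewrite exponential_pdfE// (le_trans t0).
rewrite ge0_integralZl//; last 2 first.
- by apply/measurable_EFinP/measurable_funTS; apply: measurableT_comp.
- by rewrite lee_fin ltW.
by rewrite integral_expR_tail// -EFinM mulrA divff ?mul1r// gt_eqF.
Qed.

(* The law of [X] under the finite measure [f mu] is determined by its values on
   the pi-system of the rays. *)
Lemma integral_exponential_tail d (T : measurableType d) (R : realType)
    (mu : {measure set T -> \bar R}) (f : T -> R) (X : T -> measurableTypeR R)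
    (r c : R) (phi : measurableTypeR R -> \bar R) :
  (0 < r)%R -> (0 <= c)%R ->
  measurable_fun setT f -> (forall x, (0 <= f x)%R) ->
  measurable_fun setT X ->
  (forall t, (0 <= t)%R ->
     \int[mu]_(x in [set x | (t < X x)%R]) (f x)%:E =
       (c * expR (- r * t))%:E) ->
  (forall x, (X x <= 0)%R -> f x = 0%R) ->
  measurable_fun setT phi -> (forall s, 0 <= phi s) ->
  \int[mu]_x ((f x)%:E * phi (X x)) =
  c%:E * \int[@lebesgue_measure R]_s ((exponential_pdf r s)%:E * phi s).
Proof.
move=> r0 c0 mf f0 mX tailX fX0 mphi phi0.
have [nu nuE] := density_measure mu mf f0.
pose e (s : measurableTypeR R) : R := (c * exponential_pdf r s)%R.
have me : measurable_fun setT e.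
  by apply: measurable_funM => //; exact: measurable_exponential_pdf.
have e0 s : (0 <= e s)%R by rewrite mulr_ge0// exponential_pdf_ge0// ltW.
have [eta etaE] := density_measure (@lebesgue_measure R) me e0.
have mpdf : measurable_fun [set: measurableTypeR R] (EFin \o exponential_pdf r).
  by apply/measurable_EFinP; exact: measurable_exponential_pdf.
have pdf0 s : 0 <= (exponential_pdf r s)%:E
  by rewrite lee_fin exponential_pdf_ge0// ltW.
have nu_ray t : (0 <= t)%R -> nu (X @^-1` `]t,
  +oo[%classic) = (c * expR (- r * t))%:E.
  by move=> t0; rewrite nuE preimage_itvoy; exact: tailX.
have eta_ray t : (0 <= t)%R -> eta `]t, +oo[%classic = (c * expR (- r * t))%:E.
  move=> t0; rewrite etaE/= /e; under eq_integral do rewrite EFinM.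
  rewrite ge0_integralZl//; last 1 first.
  - exact: measurable_funTS.
  by rewrite integral_exponential_gt.
have mray t : measurable (X @^-1` `]t, +oo[%classic).
  by rewrite -[X in measurable X]setTI; exact: mX.
(* The density f vanishes where X <= 0, so rays starting below 0 have the mass of the ray starting
   at 0. *)
have nu_neg t : (t < 0)%R -> nu (X @^-1` `]t, +oo[%classic) = c%:E.
  move=> t0; rewrite -[c%:E]mule1 -[1]/(1%:E) -expR0 -EFinM -(mulr0 (- r)%R) -nu_ray//.
  rewrite !nuE integral_mkcond [RHS]integral_mkcond; apply: eq_integral => x _.
  have xE a : (x \in X @^-1` `]a, +oo[%classic) = (a < X x)%R.
    by apply/idP/idP; rewrite inE/= in_itv/= andbT.
  rewrite !patchE !xE; have [Xx|/fX0 ->] := ltP 0%R (X x).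
    by rewrite (lt_trans t0).
  by case: ifP.
have eta_neg t : (t < 0)%R -> eta `]t, +oo[%classic = c%:E.
  move=> t0; rewrite -[c%:E]mule1 -[1]/(1%:E) -expR0 -EFinM -(mulr0 (- r)%R) -eta_ray//.
  rewrite !etaE [RHS]integral_itv_obnd_cbnd; last first.
    by apply: measurable_funTS; exact/measurable_EFinP.
  rewrite integral_mkcond [RHS]integral_mkcond; apply: eq_integral => x _.
  have xE a b : (x \in [set` Interval (BSide b a) +oo%O]) = (a < x ?<= if b)%R.
    by apply/idP/idP; rewrite inE/= in_itv/= andbT.
  rewrite !patchE !xE/=; have [Xx|Xx] := leP 0%R x.
    by rewrite (lt_le_trans t0).
  by case: ifP => // _; rewrite /e lt0_exponential_pdf ?mulr0.
transitivity (\int[eta]_s phi s); last first.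
  rewrite (integral_density me e0 (fun A _ => etaE A) mphi phi0).
  under eq_integral do rewrite EFinM -muleA.
  rewrite ge0_integralZl//.
  - exact: emeasurable_funM.
  - by move=> s _; rewrite mule_ge0.
pose nuX := measure_function_pushforward__canonical__measure_function_Measure nu mX.
have -> : \int[mu]_x ((f x)%:E * phi (X x)) = \int[nuX]_s phi s.
  have -> : \int[nuX]_s phi s = \int[nu]_(x in X @^-1` setT) (phi \o X) x.
    by apply: ge0_integral_pushforward => // s _.
  rewrite preimage_setT (integral_density mf f0 (fun A _ => nuE A))//.
    exact: measurableT_comp.
  by move=> x; exact: phi0.
apply: eq_measure_integral => A mA _.
refine (@measure_unique _ R (measurableTypeR R) (@RGenOInfty.G R)
  (fun n => `](- n%:R)%R, +oo[%classic) _ _ _ _ nuX eta _ _ A mA) => //.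
- exact: RGenOInfty.measurableE.
- move=> _ _ [a ->] [b ->]; exists (Num.max a b).
  by apply/seteqP; split => x /=; rewrite !in_itv/= !andbT gt_max => /andP.
- by move=> n; exists (- n%:R)%R.
- apply/seteqP; split => x // _; exists (Num.Def.archi_bound `|x|%R) => //=.
  rewrite in_itv/= andbT ltrNl (le_lt_trans _ (archi_boundP (normr_ge0 x)))//.
  by rewrite -normrN ler_norm.
- move=> _ [a ->]; have [a0|a0] := leP 0%R a.
    by rewrite eta_ray// -nu_ray.
  by rewrite eta_neg// -(nu_neg a).
- move=> n; have [a0|a0] := leP 0%R (- n%:R : R)%R.
    by rewrite [ltLHS]nu_ray// ltry.
  by rewrite [ltLHS]nu_neg// ltry.
Qed.

Section path_law.
Context (R : realType) (S : finType) (d : measure_display)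
  (Omega : measurableType d) (xi : R -> Omega -> S).
Hypothesis xi_rc : right_continuous_process xi.
Context (q : S -> S -> R) (i : S) (mu : probability Omega R).
Hypothesis mu_ctmc : is_ctmc xi q i mu.
Hypothesis q_lt0 : forall k, (q k k < 0)%R.
Hypothesis q_ge0 : forall k j, j != k -> (0 <= q j k)%R.

Lemma jump_prob_ge0 k j : (0 <= jump_prob q k j)%R.
Proof.
rewrite /jump_prob; case: ifPn => // jk.
by rewrite mulNr -mulrN -invrN mulr_ge0 ?q_ge0// invr_ge0 oppr_ge0 ltW.
Qed.

Let mem_gt (t s : R) : (s \in `]t, +oo[%classic) = (t < s)%R.
Proof. by apply/idP/idP; rewrite inE/= in_itv/= andbT. Qed.

Lemma sojourn_gt0 k n m w :
  (m < n)%N -> on_path xi k n w -> (0 < sojourn xi m w)%R.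
Proof.
move=> mn kw; have [Tm _] := kw m (ltnW mn); have [Tm1 _] := kw m.+1 mn.
by rewrite subr_gt0 -lte_fin !fineK_jump_time//; exact: lt_jump_timeS.
Qed.

Lemma sojourn_tail k n (t : nat -> R) : (forall l, (0 <= t l)%R) ->
  \int[mu]_w (\1_[set w | on_path xi k n w] w *
     \prod_(l < n) \1_(`]t l, +oo[%classic) (sojourn xi l w))%:E =
  ((k 0%N == i)%:R * \prod_(m < n) jump_prob q (k m) (k m.+1) *
    \prod_(l < n) expR (q (k l) (k l) * t l))%R%:E.
Proof.
(* The event in [is_ctmc] also bounds the sojourn in the last state k n from below. The bound 0
   holds automatically, since jump times strictly increase, and contributes the factor expR 0 =
   1. *)
move=> t0; pose t' l := if (l < n)%N then t l else 0%R.
have t'0 l : (0 <= t' l)%R by rewrite /t'; case: ifP.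
have := mu_ctmc n k t'0; set E := [set w | _]; move=> muE.
have -> : ((k 0%N == i)%:R * \prod_(m < n) jump_prob q (k m) (k m.+1) *
    \prod_(l < n) expR (q (k l) (k l) * t l))%R%:E = mu E.
  rewrite muE big_ord_recr/= {2}/t' ltnn mulr0 expR0 mulr1 mulrAC.
  by congr (_ * _ * _)%:E; apply: eq_bigr => l _; rewrite /t' ltn_ord.
have EE : E = [set w | on_path xi k n w] `&`
    \bigcap_(l in [set l | (l < n)%N]) [set w | (t l < sojourn xi l w)%R].
  apply/seteqP; split => w /=.
    move=> Ew; split => [m mn|l /= ln].
      by have [? <- _] := Ew m mn.
    have [Tl _] := Ew l (ltnW ln); have [Tl1 _ _] := Ew l.+1 ln.
    rewrite /t' ln -[X in X + _ < _]fineK_jump_time// -[X in _ < X]fineK_jump_time//.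
    by rewrite -EFinD lte_fin ltrBrDl.
  move=> [kw tw] m mn; have [Tm vm] := kw m mn; split=> //.
  rewrite /t'; case: ifPn => [ln|_]; last by rewrite adde0;
    exact: lt_jump_timeS.
  have [Tm1 _] := kw m.+1 ln.
  rewrite -[X in X + _ < _]fineK_jump_time// -[X in _ < X]fineK_jump_time//.
  by rewrite -EFinD lte_fin -ltrBrDl; exact: tw.
have mE : measurable E.
  rewrite EE; apply: measurableI; first exact: measurable_on_path.
  have [->|n0] := posnP n.
    by rewrite (_ : [set l | _] = set0) ?bigcap_set0//; apply/seteqP; split.
  apply: bigcap_measurable; first by exists 0%N.
  move=> l _; rewrite -[X in measurable X]setTI.
  rewrite (_ : [set w | _] = sojourn xi l @^-1` `]t l, +oo[%classic).
    exact: measurable_sojourn.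
  by apply/seteqP; split => w /=; rewrite in_itv/= andbT.
have -> : mu E = \int[mu]_w (\1_E w)%:E
  by rewrite (integral_indic mu measurableT mE) setIT.
apply: eq_integral => w _; congr (_%:E).
rewrite EE indicI; congr (_ * _)%R; apply/esym.
rewrite indicE; case: (boolP (_ \in _)) => wE /=.
  rewrite big1// => l _; rewrite indicE mem_gt.
  by move: wE; rewrite inE => /(_ l (ltn_ord l)) /= ->.
apply/eqP; rewrite eq_sym prodf_seq_eq0; apply: contraNT wE => h.
rewrite inE => l /= ln; move/hasPn : h => /(_ (Ordinal ln) (mem_index_enum _)).
by rewrite /= indicE mem_gt; case: (_ < _)%R => //; rewrite eqxx.
Qed.

(** Starting from [sojourn_tail], the indicators of rays are replaced by the functions psi one index
    at a time; m counts the factors already replaced. Each replacement is a one-dimensional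
    statement about the law of a single sojourn time. *)
Lemma integral_sojourns k n (psi : nat -> R -> R) (v : nat -> R) :
  (forall l, (l < n)%N -> measurable_fun setT (psi l)) ->
  (forall l s, (l < n)%N -> (0 <= psi l s)%R) ->
  (forall l, (l < n)%N ->
    \int[@lebesgue_measure R]_s
      ((exponential_pdf (- q (k l) (k l)) s)%:E * (psi l s)%:E) = (v l)%:E) ->
  \int[mu]_w (\1_[set w | on_path xi k n w] w *
     \prod_(l < n) psi l (sojourn xi l w))%:E =
  ((k 0%N == i)%:R * \prod_(m < n) jump_prob q (k m) (k m.+1) *
    \prod_(l < n) v l)%R%:E.
Proof.
move=> mpsi psi0 psiv.
have v0 l : (l < n)%N -> (0 <= v l)%R.
  move=> ln; rewrite -lee_fin -psiv// integral_ge0// => s _.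
  by rewrite mule_ge0// lee_fin ?psi0// exponential_pdf_ge0// oppr_ge0 ltW.
suff: forall m, (m <= n)%N -> forall t : nat -> R, (forall l, (0 <= t l)%R) ->
    \int[mu]_w (\1_[set w | on_path xi k n w] w *
       \prod_(l < n) (if (l < m)%N then psi l else \1_(`]t l, +oo[%classic)) (sojourn xi l w))%:E =
    ((k 0%N == i)%:R * \prod_(m < n) jump_prob q (k m) (k m.+1) *
      \prod_(l < n) (if (l < m)%N then v l else expR (q (k l) (k l) * t l)))%R%:E.
  move=> /(_ n (leqnn n) (fun=> 0%R) (fun=> lexx _)).
  have vE (t : nat -> R) :
      (\prod_(l < n) (if (l < n)%N then v l else t l) = \prod_(l < n) v l)%R.
    by apply: eq_bigr => l _; rewrite ltn_ord.
  rewrite (vE (fun l => expR (q (k l) (k l) * 0))) => <-.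
  apply: eq_integral => w _; congr (_ * _)%:E.
  by apply: eq_bigr => l _; rewrite ltn_ord.
elim=> [_ t t0|m IH mn t t0]; first exact: sojourn_tail.
pose om := Ordinal mn.
pose u l := if (l < m)%N then psi l else \1_(`]t l, +oo[%classic).
pose uv l := if (l < m)%N then v l else expR (q (k l) (k l) * t l).
have mu_u (l : 'I_n) : measurable_fun setT (u l).
  rewrite /u; case: ifPn => _; first exact: mpsi.
  exact: measurable_indic.
have u0 (l : 'I_n) s : (0 <= u l s)%R.
  by rewrite /u; case: ifPn => _; [exact: psi0|rewrite indicE ler0n].
(* All factors except the one of sojourn m form a density, under which the law of this sojourn is a
   multiple c of the exponential law. *)
pose f w := (\1_[set w | on_path xi k n w] w *
  \prod_(l < n) (if l != om then u l (sojourn xi l w) else 1))%R.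
pose J := ((k 0%N == i)%:R * \prod_(m < n) jump_prob q (k m) (k m.+1))%R : R.
have J0 : (0 <= J)%R.
  rewrite /J mulr_ge0// prodr_ge0// => l _; exact: jump_prob_ge0.
pose c := (J * \prod_(l < n | l != om) uv l)%R.
have uv_psi (l : 'I_n) :
  l != om -> (if (l < m.+1)%N then v l else expR (q (k l) (k l) * t l)) = uv l.
  move=> lm; rewrite /uv ltnS leq_eqVlt; case: eqVneq => // E.
  by move: lm; rewrite -val_eqE/= E eqxx.
have u_psi (l : 'I_n) :
  l != om -> (if (l < m.+1)%N then psi l else \1_(`]t l, +oo[%classic)) = u l.
  move=> lm; rewrite /u ltnS leq_eqVlt; case: eqVneq => // E.
  by move: lm; rewrite -val_eqE/= E eqxx.
have -> : (J * \prod_(l < n)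
    (if (l < m.+1)%N then v l else expR (q (k l) (k l) * t l)))%:E =
    c%:E * (v m)%:E.
  rewrite (bigD1 om)//= ltnSn mulrCA -EFinM mulrC; congr (_ * _ * _)%:E.
  exact: eq_bigr.
rewrite -psiv//.
rewrite -(@integral_exponential_tail _ _ _ mu f (sojourn xi m) _ c)//.
- apply: eq_integral => w _; rewrite -EFinM; congr (_%:E).
  rewrite /f -mulrA [in LHS](bigD1 om)//= ltnSn; congr (_ * _)%R; rewrite mulrC.
  by congr (_ * _)%R; rewrite big_mkcond/=; apply: eq_bigr => l _;
    case: ifPn => // /u_psi ->.
- by rewrite oppr_gt0.
- rewrite /c mulr_ge0// prodr_ge0// => l _; rewrite /uv; case: ifPn => _;
    last exact: expR_ge0.
  exact: v0.
- apply: measurable_funM.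
    exact/measurable_indic/measurable_on_path.
  apply: measurable_prod => l _; case: (l != om) => //.
  exact: (measurableT_comp (mu_u l) (measurable_sojourn xi_rc l)).
- move=> w; rewrite /f mulr_ge0// prodr_ge0// => l _; case: ifPn => // _;
    exact: u0.
- exact: measurable_sojourn.
(* The tail of sojourn m at s under f is the induction hypothesis with the free threshold at index m
   set to s. *)
- move=> s s0; pose t' l := if l == m then s else t l.
  have t'0 l : (0 <= t' l)%R by rewrite /t'; case: ifP.
  have := IH (ltnW mn) t' t'0.
  have -> : (\prod_(l < n) (if (l < m)%N then v l else expR (q (k l) (k l) * t' l)) =
             (\prod_(l < n | l != om) uv l) * expR (q (k m) (k m) * s))%R.
    rewrite (bigD1 om)//= ltnn /t' eqxx mulrC; congr (_ * _)%R.
    by apply: eq_bigr => l lm; rewrite /uv -[m]/(val om) val_eqE (negbTE lm).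
  rewrite -/J mulrA opprK => <-; rewrite integral_mkcond;
    apply: eq_integral => w _.
  have -> : (\prod_(l < n)
      (if (l < m)%N then psi l else \1_(`]t' l, +oo[%classic)) (sojourn xi l w) =
    \1_(`]s, +oo[%classic) (sojourn xi m w) *
    \prod_(l < n) (if l != om then u l (sojourn xi l w) else 1))%R.
    rewrite (bigD1 om)//= ltnn /t' eqxx; congr (_ * _)%R; rewrite big_mkcond/=.
    apply: eq_bigr => l _; case: ifPn => // lm.
    by rewrite /u -[m]/(val om) val_eqE (negbTE lm).
  rewrite mulrCA -/(f w) patchE indicE mem_gt.
  have -> : (w \in [set x | (s < sojourn xi m x)%R]) = (s < sojourn xi m w)%R.
    by apply/idP/idP; rewrite inE.
  by case: ltP; rewrite ?mul1r ?mul0r.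
- move=> w Sw; rewrite /f indicE; case: (boolP (_ \in _)) => [|_];
    last by rewrite mul0r.
  by rewrite inE/= => /(sojourn_gt0 mn); rewrite ltNge Sw.
- by apply/measurable_EFinP; exact: mpsi.
- by move=> s; rewrite lee_fin psi0.
Qed.
End path_law.

(** * Expected exponential passage cost *)

Definition exp_int (R : realType) (b : R) : \bar R :=
  \int[@lebesgue_measure R]_(s in `[0%R, +oo[) (expR (b * s))%:E.

Section exp_int.
Context (R : realType).
Implicit Types b : R.

Lemma exp_int_lt0 b : (b < 0)%R -> exp_int b = ((- b)^-1)%:E.
Proof.
move=> b0; have := @integral_expR_tail R (- b)%R 0%R;
  rewrite oppr_gt0 => /(_ b0).
by rewrite opprK mulr0 expR0 mulr1.
Qed.

Lemma exp_int_ge0 b : (0 <= b)%R -> exp_int b = +oo.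
Proof.
move=> b0; apply/eqP; rewrite -leye_eq.
have <- : \int[@lebesgue_measure R]_(s in `[0%R, +oo[) (cst 1 s) = +oo :> \bar R.
  by rewrite integral_cst//= lebesgue_measure_itv/= ltry mul1e.
apply: ge0_le_integral => //.
- apply/measurable_EFinP/measurable_funTS; exact: measurableT_comp.
- by move=> s; rewrite /= in_itv/= andbT => s0;
    rewrite lee_fin -expR0 ler_expR mulr_ge0.
Qed.

Lemma exp_int_gt0 b : 0 < exp_int b.
Proof.
have [b0|b0] := ltP b 0%R; last by rewrite exp_int_ge0.
by rewrite exp_int_lt0// lte_fin invr_gt0 oppr_gt0.
Qed.

Lemma le_exp_int b b' : (b <= b')%R -> exp_int b <= exp_int b'.
Proof.
move=> bb'; have [b'0|b'0] := ltP b' 0%R;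
  last by rewrite (exp_int_ge0 b'0) leey.
rewrite !exp_int_lt0//; last exact: le_lt_trans b'0.
by rewrite lee_fin lef_pV2 ?posrE ?oppr_gt0// ?lerN2//; exact: le_lt_trans b'0.
Qed.

Lemma integral_exponential_expR (r a : R) : (0 < r)%R -> (a - r < 0)%R ->
  \int[@lebesgue_measure R]_s ((exponential_pdf r s)%:E * (expR (a * s))%:E) =
  (r / (r - a))%:E.
Proof.
move=> r0 ar.
transitivity (\int[@lebesgue_measure R]_(s in `[0%R, +oo[) (r%:E * (expR ((a - r) * s))%:E)).
  rewrite [RHS]integral_mkcond; apply: eq_integral => s _; rewrite patchE.
  have -> : (s \in `[0%R, +oo[%classic) = (0 <= s)%R.
    by apply/idP/idP; rewrite inE/= in_itv/= andbT.
  case: leP => s0; last by rewrite lt0_exponential_pdf// mul0e.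
  by rewrite exponential_pdfE// -!EFinM -mulrA -expRD mulrBl mulNr addrC.
rewrite ge0_integralZl//; last 2 first.
- apply/measurable_EFinP/measurable_funTS; exact: measurableT_comp.
- by rewrite lee_fin ltW.
by rewrite -/(exp_int _) exp_int_lt0// opprB.
Qed.

End exp_int.

Section path_weight.
Context (R : realType) (S : finType).
Implicit Types (w : S -> S -> \bar R) (s : seq S).

Fixpoint path_weight w i s : \bar R :=
  if s is j :: s' then w i j * path_weight w j s' else 1.

Lemma path_weight_ge0 w i s :
  (forall i j, 0 <= w i j) -> 0 <= path_weight w i s.
Proof. by move=> w0; elim: s i => [|j s IH] i //=; rewrite mule_ge0. Qed.

Lemma path_weight_prod z w (a : S -> S -> R) i s :
  (forall l, (l < size s)%N -> w (nth z (i :: s) l) (nth z (i :: s) l.+1) =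
     (a (nth z (i :: s) l) (nth z (i :: s) l.+1))%:E) ->
  path_weight w i s =
  (\prod_(l < size s) a (nth z (i :: s) l) (nth z (i :: s) l.+1))%:E.
Proof.
elim: s i => [|j s IH] i wa /=; first by rewrite big_ord0.
rewrite big_ord_recl EFinM (wa 0%N)//= (IH j)// => l ls.
exact: (wa l.+1).
Qed.

Lemma path_weight_gt0 w w' i s : (forall i j, 0 <= w i j) ->
  (forall i j, 0 < w i j -> 0 < w' i j) -> 0 < path_weight w i s ->
  0 < path_weight w' i s.
Proof.
move=> w0 ww'; elim: s i => [|j s IH] i //= h.
have s_gt0 : 0 < path_weight w j s.
  by rewrite lt0e path_weight_ge0// andbT; apply: contraTN h => /eqP ->;
    rewrite mule0 ltxx.
have w_gt0 : 0 < w i j.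
  by rewrite lt0e w0 andbT; apply: contraTN h => /eqP ->; rewrite mul0e ltxx.
by rewrite mule_gt0 ?ww' ?IH.
Qed.

Lemma path_weight_step_gt0 z w i s l : (forall i j, 0 <= w i j) ->
  0 < path_weight w i s -> (l < size s)%N ->
  0 < w (nth z (i :: s) l) (nth z (i :: s) l.+1).
Proof.
move=> w0; elim: s i l => [//|j s IH] i l /= h.
have s_gt0 : 0 < path_weight w j s.
  by rewrite lt0e path_weight_ge0// andbT; apply: contraTN h => /eqP ->;
    rewrite mule0 ltxx.
case: l => [_|l] /=; last by rewrite ltnS; exact: IH.
by rewrite lt0e w0 andbT; apply: contraTN h => /eqP ->; rewrite mul0e ltxx.
Qed.

Lemma path_weight_eqy z w i s l : (forall i j, 0 <= w i j) ->
  0 < path_weight w i s -> (l < size s)%N ->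
  w (nth z (i :: s) l) (nth z (i :: s) l.+1) = +oo -> path_weight w i s = +oo.
Proof.
move=> w0; elim: s i l => [//|j s IH] i l /= h.
have s_gt0 : 0 < path_weight w j s.
  by rewrite lt0e path_weight_ge0// andbT; apply: contraTN h => /eqP ->;
    rewrite mule0 ltxx.
have w_gt0 : 0 < w i j.
  by rewrite lt0e w0 andbT; apply: contraTN h => /eqP ->; rewrite mul0e ltxx.
case: l => [|l] /=; first by move=> _ ->; rewrite gt0_mulye.
by rewrite ltnS => ls /(IH j l s_gt0 ls) ->; rewrite gt0_muley.
Qed.

(** A quantitative blow-up: [w_ e] approximates w as e tends to 0, finite positive entries staying
    above a constant and infinite ones growing at least like 1/e. Since 1/e >= 1, a product with at
    least one infinite factor still grows at least like 1/e. *)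
Lemma path_weight_lbound w (w_ : R -> S -> S -> \bar R) i s :
  (forall i j, 0 <= w i j) ->
  (forall i j, 0 < w i j -> exists2 c : R, (0 < c)%R & forall e, (0 < e <= 1)%R ->
     (if w i j == +oo%E then c / e else c)%:E <= w_ e i j) ->
  0 < path_weight w i s -> exists2 c : R, (0 < c)%R & forall e,
    (0 < e <= 1)%R ->
     (if path_weight w i s == +oo%E then c / e else c)%:E <=
       path_weight (w_ e) i s.
Proof.
move=> w0 w_lb; elim: s i => [|j s IH] i /= h.
  by exists 1%R => // e _; rewrite ifF.
have s_gt0 : 0 < path_weight w j s.
  by rewrite lt0e path_weight_ge0// andbT; apply: contraTN h => /eqP ->;
    rewrite mule0 ltxx.
have w_gt0 : 0 < w i j.
  by rewrite lt0e w0 andbT; apply: contraTN h => /eqP ->; rewrite mul0e ltxx.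
have [c c0 hc] := w_lb _ _ w_gt0; have [c' c'0 hc'] := IH _ s_gt0.
exists (c * c')%R; first exact: mulr_gt0.
move=> e e01; have /andP[e0 e1] := e01.
have einv : (1 <= e^-1)%R by rewrite invf_ge1.
apply: le_trans (lee_pmul _ _ (hc e e01) (hc' e e01)); last 2 first.
- by rewrite lee_fin; case: ifP => _; rewrite ?divr_ge0 ?ltW.
- by rewrite lee_fin; case: ifP => _; rewrite ?divr_ge0 ?ltW.
rewrite -EFinM lee_fin.
have cc0 : (0 < c * c')%R by exact: mulr_gt0.
case: (eqVneq (w i j)) => [_|wy]; case: (eqVneq (path_weight w j s)) => [_|sy].
- case: ifP => _; rewrite mulrACA.
    by rewrite ler_wpM2l ?(ltW cc0)// ler_peMl// (le_trans _ einv).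
  rewrite ler_peMr ?(ltW cc0)// -(mulr1 1%R) ler_pM//.
- case: ifP => _; rewrite mulrAC// ler_peMr// ltW//.
- case: ifP => _; rewrite mulrA// ler_peMr// ltW//.
- rewrite ifF//; apply/negbTE.
  rewrite -ltey -ge0_fin_numE ?mule_ge0 ?path_weight_ge0// fin_numM//.
    by rewrite ge0_fin_numE// ltey.
  by rewrite ge0_fin_numE ?path_weight_ge0// ltey.
Qed.

End path_weight.

(** Jump probability -p/r times the mean of e^(b S), for S exponential of rate -r, equals the finite
    value of [exp_int] at b + r times the rate p. *)
Lemma jump_prob_mean (R : realType) (p r b : R) : (r < 0)%R -> (b + r < 0)%R ->
  (- p / r * (- r / (- r - b)) = (- (b + r))^-1 * p)%R.
Proof.
move=> r0 br0; field; rewrite lt_eqF//= (lt_eqF r0) andbT gt_eqF//; lra.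
Qed.

Section path_integral.
Context (R : realType) (S : finType) (d : measure_display)
  (Omega : measurableType d) (xi : R -> Omega -> S).
Hypothesis xi_rc : right_continuous_process xi.
Context (q : S -> S -> R) (i : S) (mu : probability Omega R) (z : S).
Hypothesis mu_ctmc : is_ctmc xi q i mu.
Hypothesis q_lt0 : forall k, (q k k < 0)%R.
Hypothesis q_ge0 : forall k j, j != k -> (0 <= q j k)%R.
Implicit Types a : S -> R.

Definition path_set s := [set w | on_path xi (nth z (i :: s)) (size s) w].

(* E[e^(a_k S); jump to j] for the exponential sojourn time S in k. *)
Definition rate_weight a k j : \bar R :=
  if j == k then 0 else exp_int (a k + q k k) * (q j k)%:E.

Lemma rate_weight_ge0 a k j : 0 <= rate_weight a k j.
Proof.
rewrite /rate_weight; case: ifPn => // jk.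
by rewrite mule_ge0 ?lee_fin ?q_ge0// ltW// exp_int_gt0.
Qed.

Definition path_exp a s w : R :=
  (\prod_(l < size s) expR (a (nth z (i :: s) l) * sojourn xi l w))%R.

Lemma path_exp_ge0 a s w : (0 <= path_exp a s w)%R.
Proof. by rewrite prodr_ge0// => l _; exact: expR_ge0. Qed.

Lemma measurable_path_exp a s : measurable_fun setT (path_exp a s).
Proof.
apply: measurable_prod => l _; apply: measurableT_comp => //.
by apply: measurable_funM => //; exact: measurable_sojourn.
Qed.

Lemma measurable_path_set s : measurable (path_set s).
Proof. exact: measurable_on_path. Qed.

Let integral_path_lt0 a s :
  (forall l, (l < size s)%N ->
    (a (nth z (i :: s) l) + q (nth z (i :: s) l) (nth z (i :: s) l) < 0)%R) ->
  \int[mu]_(w in path_set s) (path_exp a s w)%:E =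
    path_weight (rate_weight a) i s.
Proof.
set k := nth z (i :: s) => ak.
rewrite (@path_weight_prod _ _ z _ (fun k j =>
    if j == k then 0%R else ((- (a k + q k k))^-1 * q j k)%R)); last first.
  move=> l ls; rewrite /rate_weight; case: ifP => // _.
  by rewrite exp_int_lt0// ak.
have := @integral_sojourns _ _ _ _ _ xi_rc q i mu mu_ctmc q_lt0 q_ge0 k (size s)
  (fun l x => expR (a (k l) * x)) (fun l => - q (k l) (k l) / (- q (k l) (k l) - a (k l)))%R.
rewrite [k 0%N]/= eqxx mul1r -big_split/= => h.
transitivity (\int[mu]_w (\1_(path_set s) w * path_exp a s w)%:E).
  rewrite integral_mkcond; apply: eq_integral => w _; rewrite patchE indicE.
  by case: ifP; rewrite ?mul1r ?mul0r.
rewrite [LHS]h.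
- congr (_%:E); apply: eq_bigr => l _; rewrite /jump_prob -/k.
  case: ifP => _; first by rewrite mul0r.
  by rewrite jump_prob_mean// ak.
- by move=> l ls; apply: measurableT_comp => //; exact: measurable_funM.
- by move=> l x ls; exact: expR_ge0.
- move=> l ls; rewrite integral_exponential_expR ?oppr_gt0// opprK; exact: ak.
Qed.

(** Infinite values are included. Apart from the subcritical case, either the weight is 0, which
    forces a forbidden jump and makes the path a null event, or it is positive with an infinite
    factor and the integral diverges. *)
Lemma integral_path a s :
  \int[mu]_(w in path_set s) (path_exp a s w)%:E =
    path_weight (rate_weight a) i s.
Proof.
have w0 := rate_weight_ge0 a.
have [ak|] := pselect (forall l, (l < size s)%N ->
    (a (nth z (i :: s) l) + q (nth z (i :: s) l) (nth z (i :: s) l) < 0)%R).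
  exact: integral_path_lt0.
move=> /existsNP[l /not_implyP[ls /negP]]; rewrite -leNgt => al.
have [pw0|] := ltP 0 (path_weight (rate_weight a) i s); last first.
  rewrite le_eqVlt [X in _ || X]ltNge path_weight_ge0//= orbF => /eqP pw0.
  rewrite pw0; apply: null_set_integral; first exact: measurable_path_set.
    by apply: measurable_funTS; apply/measurable_EFinP;
      exact: measurable_path_exp.
  (* For a = 0 the integral is the probability of the path, and weights for different a are positive
     on the same jumps because [exp_int] is positive. *)
  suff muE : mu (path_set s) = path_weight (rate_weight (fun=> 0%R)) i s.
    rewrite [LHS]muE.
    apply/eqP; rewrite eq_le path_weight_ge0 ?andbT;
      last exact: rate_weight_ge0.
    rewrite leNgt; apply/negP => pos;
      have := @path_weight_gt0 _ _ _ (rate_weight a) _ _ _ _ pos.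
    rewrite pw0 ltxx => /(_ (rate_weight_ge0 _)) h; suff: false by [];
      apply: h => k j.
    rewrite /rate_weight; case: ifP => // _; rewrite add0r exp_int_lt0// -EFinM.
    rewrite lte_fin pmulr_rgt0 ?invr_gt0 ?oppr_gt0// => qkj.
    by rewrite mule_gt0 ?exp_int_gt0.
  rewrite -integral_path_lt0; last by move=> m _; rewrite add0r.
  rewrite (eq_integral (cst 1)); first by rewrite integral_cst ?mul1e//;
    exact: measurable_path_set.
  by move=> w _; rewrite /path_exp big1// => m _; rewrite mul0r expR0.
(* Lower the exponents with an infinite integral to - q(k|k) - e and let e go to 0. *)
pose a_ e k := if (a k + q k k < 0)%R then a k else (- q k k - e)%R.
have [c c0 hc] : exists2 c : R, (0 < c)%R & forall e, (0 < e <= 1)%R ->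
     (if path_weight (rate_weight a) i s == +oo%E then c / e else c)%:E <=
     path_weight (rate_weight (a_ e)) i s.
  apply: path_weight_lbound => // k j; rewrite /rate_weight.
  case: ifP => [_|/negbT jk]; first by rewrite ltxx.
  move=> wkj; have qkj : (0 < q j k)%R.
    by rewrite lt_neqAle eq_sym q_ge0// andbT; apply: contraTneq wkj => ->;
      rewrite mule0 ltxx.
  rewrite /a_; case: ltP => aq.
    exists ((- (a k + q k k))^-1 * q j k)%R;
      first by rewrite mulr_gt0// invr_gt0 oppr_gt0.
    by move=> e _; rewrite exp_int_lt0.
  exists (q j k) => // e /andP[e0 _];
    rewrite exp_int_ge0// gt0_mulye ?lte_fin//= exp_int_lt0; last by lra.
  by rewrite -EFinM lee_fin mulrC (_ : (- (- q k k - e + q k k) = e)%R)//; lra.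
have a_le e k : (0 < e)%R -> (a_ e k <= a k)%R by rewrite /a_ => e0;
  case: ltP => aq /=; lra.
have a_lt0 e k : (0 < e)%R -> (a_ e k + q k k < 0)%R by rewrite /a_ => e0;
  case: (ltP (a k + q k k) 0)%R => aq; lra.
have pwy : path_weight (rate_weight a) i s = +oo.
  have := @path_weight_step_gt0 _ _ z _ _ _ _ w0 pw0 ls.
  move=> st0; apply: (@path_weight_eqy _ _ z _ _ _ _ w0 pw0 ls); move: st0.
  rewrite /rate_weight exp_int_ge0//; case: ifPn => [|jk];
    first by rewrite ltxx.
  have [->|qkj] := eqVneq (q (nth z (i :: s) l.+1) (nth z (i :: s) l)) 0%R.
    by rewrite mule0 ltxx.
  move=> _.
  by rewrite gt0_mulye// lt0e eqe qkj lee_fin q_ge0.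
rewrite pwy; apply/eq_infty => r; rewrite pwy eqxx in hc.
(* Chosen so that c / e = c + |r| exceeds r while e <= 1. *)
pose e := (c / (c + `|r|))%R; have cr : (0 < c + `|r|)%R by rewrite ltr_pwDl.
have e0 : (0 < e)%R by rewrite divr_gt0.
have e1 : (e <= 1)%R by rewrite ler_pdivrMr// mul1r lerDl.
apply: (@le_trans _ _ (c / e)%:E).
  by rewrite lee_fin /e invf_div mulrCA divff ?gt_eqF// mulr1 (le_trans (ler_norm r))// lerDr ltW.
apply: le_trans (hc e _) _; first by rewrite e0.
rewrite -integral_path_lt0; last by move=> m _; exact: a_lt0.
apply: ge0_le_integral => //.
- exact: measurable_path_set.
- by move=> w _; rewrite lee_fin path_exp_ge0.
- by apply: measurable_funTS; apply/measurable_EFinP;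
    exact: measurable_path_exp.
- by apply: measurable_funTS; apply/measurable_EFinP;
    exact: measurable_path_exp.
move=> w sw; rewrite lee_fin; apply: ler_prod => m _.
rewrite expR_ge0 ler_expR ler_wpM2r ?a_le//.
by apply/ltW; exact: (sojourn_gt0 xi_rc (ltn_ord m) sw).
Qed.
End path_integral.

(** * Irreducibility as an induction principle *)

Section irreducible.
Context (R : realType) (S : finType) (q : S -> S -> R).
Hypothesis q_irr : irreducible_rates q.
Hypothesis q_ge0 : forall k j, j != k -> (0 <= q j k)%R.

(** A path of positive rates from a state outside D to z must at some step enter D, against the
    closure of D under predecessors. *)
Lemma irreducible_reach (D : S -> Prop) z : D z ->
  (forall k j, D j -> j != k -> (0 < q j k)%R -> D k) -> forall k, D k.
Proof.
move=> Dz DS k; apply: contrapT => nDk.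
have kz : k != z by apply: contra_notN nDk => /eqP ->.
have step x y : ~ D x -> D y -> q y x != 0%R -> False.
  move=> nDx Dy qyx; have yx : y != x by apply: contra_notN nDx => /eqP <-.
  by apply/nDx/(DS _ _ Dy yx); rewrite lt0r qyx q_ge0.
have [s [_ /gt_eqF/negbT]] := q_irr kz; move: {kz}k nDk => x nDx.
elim: s x nDx => [|y s IH] x nDx /=; first by rewrite big_seq1/=; exact: step.
rewrite big_cons/= mulf_eq0 negb_or => /andP[qyx h].
by have [Dy|nDy] := pselect (D y); [exact: step qyx|exact: IH nDy h].
Qed.

(** If q k k were 0, all rates out of k would vanish; the complement of k, nonempty since there are
    two states, would be closed under predecessors and hence contain k. *)
Lemma irreducible_diag_lt0 : (1 < #|S|)%N -> (forall k, \sum_j q j k = 0)%R ->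
  forall k, (q k k < 0)%R.
Proof.
move=> S1 q0 k; have qkk : (q k k = - \sum_(j | j != k) q j k)%R.
  by have := q0 k; rewrite (bigD1 k)//= => /eqP; rewrite addr_eq0 => /eqP.
rewrite qkk oppr_lt0 lt0r sumr_ge0 ?andbT; last by move=> j jk; exact: q_ge0.
apply/negP; rewrite psumr_eq0 => [/allP q_eq0|j jk]; last exact: q_ge0.
have /card_gt0P[x] : (0 < #|predC1 k|)%N by rewrite cardC1 -subn1 subn_gt0.
rewrite inE => /eqP xk.
have := @irreducible_reach (fun j => j <> k) x xk _ k;
  apply => // l j jk jl qjl lk.
have := q_eq0 j (mem_index_enum _); rewrite -lk jl /= => /eqP qjl0.
by rewrite qjl0 ltxx in qjl.
Qed.
End irreducible.

(** * First hitting of z as a countable disjoint union of paths *)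

Section avoiding.
Context (S : finType) (z : S).

Fixpoint avoiding n : seq (seq S) :=
  if n is m.+1 then [seq j :: s | j <- enum (predC1 z), s <- avoiding m] else [:: [::]].

Lemma mem_avoiding n s : (s \in avoiding n) = (size s == n) && (z \notin s).
Proof.
elim: n s => [|n IH] s /=; first by case: s.
apply/allpairsP/andP => [[[j t] /= [jz tn ->]]|[sn zs]].
  move: jz tn; rewrite mem_enum !inE IH eqSS => jz /andP[-> tz].
  by rewrite /= negb_or eq_sym jz.
case: s sn zs => // j s; rewrite inE negb_or eqSS => sn /andP[jz zs].
by exists (j, s); rewrite mem_enum !inE IH sn eq_sym jz.
Qed.

Lemma avoiding_uniq n : uniq (avoiding n).
Proof.
elim: n => [//|n IH] /=; apply: allpairs_uniq => //; first exact: enum_uniq.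
by move=> [j s] [j' s'] _ _ /= [-> ->].
Qed.

Lemma hit_at_paths (R : realType) (w : S -> S -> \bar R) n i :
  (forall i j, 0 <= w i j) ->
  hit_at z w n i = \sum_(s <- avoiding n) path_weight w i (rcons s z).
Proof.
move=> w0; elim: n i => [|n IH] i /=; first by rewrite big_seq1/= mule1.
rewrite big_allpairs_dep/= big_enum/=; apply: eq_bigr => j _.
by rewrite IH ge0_sume_distrr// => s _; exact: path_weight_ge0.
Qed.

End avoiding.

Lemma measurable_fun_bigsetU d1 d2 (T1 : measurableType d1) (T2 : measurableType d2)
    (I : eqType) (r : seq I) (E : I -> set T1) (f : T1 -> T2) :
  (forall i, i \in r -> measurable (E i)) ->
  (forall i, i \in r -> measurable_fun (E i) f) ->
  measurable_fun (\big[setU/set0]_(i <- r) E i) f.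
Proof.
elim: r => [|i r IH] mE mf; first by rewrite big_nil;
  exact: measurable_fun_set0.
rewrite big_cons; apply/measurable_funU.
- by apply: mE; rewrite mem_head.
- rewrite big_seq; apply: bigsetU_measurable => j jr; apply: mE.
  by rewrite inE jr orbT.
- split; first by apply: mf; rewrite mem_head.
  by apply: IH => j jr; [apply: mE|apply: mf]; rewrite inE jr orbT.
Qed.

Section conull.
Import HBNNSimple.

(* The passage cost is only known to be measurable where z is eventually hit,
   hence the detour by the simple functions below [F]. *)
Lemma ge0_integral_conull d (T : measurableType d) (R : realType)
    (mu : {measure set T -> \bar R}) (U : set T) (F : T -> \bar R) :
  measurable U -> mu (~` U) = 0 -> measurable_fun U F -> (forall x, 0 <= F x) ->
  \int[mu]_x F x = \int[mu]_(x in U) F x.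
Proof.
move=> mU U0 mF F0; apply/eqP; rewrite eq_le; apply/andP; split.
  rewrite ge0_integralTE//; apply: ge_ereal_sup => _ [h /= hF <-].
  rewrite -integralT_nnsfun (@ge0_negligible_integral _ _ _ mu setT (~` U))//;
    last 3 first.
  - exact: measurableC.
  - exact/measurable_EFinP.
  - by move=> x _; rewrite lee_fin.
  rewrite setDE setTI setCK; apply: ge0_le_integral => //.
  - by move=> x _; rewrite lee_fin.
  - exact/measurable_funTS/measurable_EFinP.
rewrite integral_mkcond !ge0_integralTE//; last first.
  by move=> x; rewrite patchE; case: ifP.
apply: ereal_sup_le => _ [h /= hF <-]; exists h => // x.
by rewrite (le_trans (hF x))// patchE; case: ifP.
Qed.

End conull.

Section hitting_expectation.
Context (R : realType) (S : finType) (d : measure_display)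
  (Omega : measurableType d) (xi : R -> Omega -> S).
Hypothesis xi_rc : right_continuous_process xi.
Context (q : S -> S -> R) (i : S) (mu : probability Omega R) (z : S).
Hypothesis mu_ctmc : is_ctmc xi q i mu.
Hypothesis q_lt0 : forall k, (q k k < 0)%R.
Hypothesis q_ge0 : forall k j, j != k -> (0 <= q j k)%R.

Local Notation hit_path s := (path_set xi i z (rcons s z)).

Definition hit_jump n := \bigcup_(s in [set` avoiding z n]) hit_path s.

Definition hit_event := \bigcup_n hit_jump n.

Lemma hit_jumpE n : hit_jump n = \big[setU/set0]_(s <- avoiding z n) hit_path s.
Proof. by rewrite /hit_jump bigcup_seq. Qed.

Lemma measurable_hit_jump n : measurable (hit_jump n).
Proof.
by rewrite hit_jumpE; apply: bigsetU_measurable => s _;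
  exact: measurable_path_set.
Qed.

Lemma measurable_hit_event : measurable hit_event.
Proof. by apply: bigcup_measurable => n _; exact: measurable_hit_jump. Qed.

Lemma path_set_inj s t w : size s = size t ->
  path_set xi i z s w -> path_set xi i z t w -> s = t.
Proof.
move=> st sw tw; apply: (@eq_from_nth _ z) => // l ls.
have [_ /= <-] := sw l.+1 ls; by rewrite st in ls; have [_ /= <-] := tw l.+1 ls.
Qed.

Lemma trivIset_hit_path n : trivIset [set` avoiding z n] (fun s => hit_path s).
Proof.
apply/trivIsetP => s t /=;
  rewrite !mem_avoiding => /andP[/eqP ss _] /andP[/eqP st _] s_neq_t.
apply/seteqP; split => // w [sw tw]; move/eqP: s_neq_t; apply.
have := path_set_inj _ sw tw; rewrite !size_rcons ss st => /(_ erefl).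
by move/rcons_inj => [].
Qed.

(** The end point z of the shorter path would be an intermediate state of the longer one, which
    avoids z. *)
Lemma trivIset_hit_jump : trivIset setT hit_jump.
Proof.
apply: ltn_trivIset => m n mn; apply/seteqP;
  split => // w [[s /= + sw] [t /= + tw]].
rewrite !mem_avoiding => /andP[/eqP sm zs] /andP[/eqP tn zt].
have nt : (n.+1 <= size (rcons t z))%N by rewrite size_rcons tn ltnS ltnW.
have ns : (n.+1 <= size (rcons s z))%N by rewrite size_rcons sm.
have [_ /= vt] := tw n.+1 nt; have [_ /= vs] := sw n.+1 ns.
move: vt; rewrite vs !nth_rcons sm ltnn eqxx tn mn => tz.
by move/negP: zt; apply; rewrite tz mem_nth// tn.
Qed.

(** F is prescribed only along hitting paths, so that the statement serves twice: F = 1 with a = 0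
    gives the probability of hitting z, and the exponential passage cost gives its expectation. *)
Lemma integral_hit_event (a : S -> R) (F : Omega -> \bar R) :
  (forall w, 0 <= F w) ->
  (forall s w, z \notin s -> hit_path s w -> F w = (path_exp xi i z a (rcons s z) w)%:E) ->
  measurable_fun hit_event F /\
  \int[mu]_(w in hit_event) F w = hit z (rate_weight q a) i.
Proof.
move=> F0 FE.
have mFp n s : s \in avoiding z n -> measurable_fun (hit_path s) F.
  rewrite mem_avoiding => /andP[_ zs].
  apply: (eq_measurable_fun (fun w => (path_exp xi i z a (rcons s z) w)%:E)).
    by move=> w; rewrite inE => /FE ->.
  by apply: measurable_funTS; apply/measurable_EFinP;
    exact: measurable_path_exp.
have mFj n : measurable_fun (hit_jump n) F.
  rewrite hit_jumpE; apply: measurable_fun_bigsetU => s ns; last exact: mFp ns.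
  exact: measurable_path_set.
have mF : measurable_fun hit_event F.
  by apply/measurable_fun_bigcup => // n; exact: measurable_hit_jump.
split => //; rewrite ge0_integral_bigcup//; last 2 first.
- exact: measurable_hit_jump.
- exact: trivIset_hit_jump.
apply: eq_eseriesr => n _; rewrite hit_at_paths; last exact: rate_weight_ge0.
rewrite hit_jumpE ge0_integral_bigsetU//; last 4 first.
- by move=> s; exact: measurable_path_set.
- exact: avoiding_uniq.
- exact: trivIset_hit_path.
- by rewrite -hit_jumpE.
rewrite !big_seq; apply: eq_bigr => s; rewrite mem_avoiding => /andP[_ zs].
rewrite -(integral_path xi_rc z mu_ctmc)//; apply: eq_integral => w;
  rewrite inE.
exact: FE.
Qed.

Hypothesis q_sum0 : forall k, (\sum_j q j k = 0)%R.
Hypothesis q_irr : irreducible_rates q.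

(** For a = 0 the weights are the transition probabilities of the embedded jump chain. *)
Lemma sum_rate_weight0 k : \sum_j rate_weight q (fun=> 0%R) k j = 1.
Proof.
rewrite (bigD1 k)//= {1}/rate_weight eqxx add0e.
rewrite (eq_bigr (fun j => ((- q k k)^-1 * q j k)%:E)); last first.
  by move=> j /negbTE jk; rewrite /rate_weight jk add0r exp_int_lt0.
rewrite sumEFin -mulr_sumr; congr (_%:E).
have := q_sum0 k; rewrite (bigD1 k)//= => /eqP;
  rewrite addrC addr_eq0 => /eqP ->.
by rewrite mulVf// oppr_eq0 lt_eqF.
Qed.

Lemma hit_event_conull : mu (~` hit_event) = 0.
Proof.
suff mu1 : mu hit_event = 1.
  by rewrite probability_setC ?mu1 ?subee//; exact: measurable_hit_event.
have [|_] := @integral_hit_event (fun=> 0%R) (cst 1) (fun=> lee01).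
  by move=> s w _ _; rewrite /path_exp big1// => l _; rewrite mul0r expR0.
rewrite integral_cst ?mul1e; last exact: measurable_hit_event.
move=> ->; apply: hit_eq1 => [|k|D Dz DS].
- exact: rate_weight_ge0.
- exact: sum_rate_weight0.
- apply: (irreducible_reach q_irr q_ge0 Dz) => k j Dj jk qjk; apply: DS Dj _.
  by rewrite /rate_weight (negbTE jk) mule_gt0 ?exp_int_gt0.
Qed.

Lemma expectation_hit (a : S -> R) (F : Omega -> \bar R) :
  (forall w, 0 <= F w) ->
  (forall s w, z \notin s -> hit_path s w -> F w = (path_exp xi i z a (rcons s z) w)%:E) ->
  \int[mu]_w F w = hit z (rate_weight q a) i.
Proof.
move=> F0 FE; have [mF <-] := integral_hit_event F0 FE.
apply: ge0_integral_conull => //; first exact: measurable_hit_event.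
exact: hit_event_conull.
Qed.

End hitting_expectation.

(** * Lower limits and strict supersolutions *)

Section lower_limits.
Context (R : realType).

Lemma lt_EFin_between (r : R) (y : \bar R) : r%:E < y ->
  exists2 c : R, (r < c)%R & c%:E < y.
Proof.
case: y => [y|_|//]; last by exists (r + 1)%R; rewrite ?ltrDl// ltry.
by rewrite lte_fin => ry; exists ((r + y) / 2)%R; rewrite ?lte_fin; lra.
Qed.

Context (T : Type) (F : set_system T) (FF : Filter F).
Implicit Types (f g : T -> \bar R) (x y l : \bar R).

(** This says that l is at most the limit inferior of f along F; real levels r suffice and match
    [lower_semicontinuous]. *)
Definition lower_limit f l := forall r : R, r%:E < l -> \forall t \near F,
  r%:E < f t.

Lemma lower_limit_cst l : lower_limit (fun=> l) l.
Proof. by move=> r rl; exact: nearW. Qed.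

Lemma lower_limit_cvg f l : f t @[t --> F] --> l -> lower_limit f l.
Proof.
move=> fl r rl; apply: (fl [set y | r%:E < y]).
by apply: open_nbhs_nbhs; split => //; exact: open_ereal_gt_ereal.
Qed.

Lemma lower_limitD f g x y : 0 <= x -> 0 <= y ->
  lower_limit f x -> lower_limit g y ->
    lower_limit (fun t => f t + g t) (x + y).
Proof.
move=> x0 y0 fx gy r rxy.
have [b bx [c cy rbc]] : exists2 b : R, b%:E < x & exists2 c : R,
  c%:E < y & (r <= b + c)%R.
  case: x x0 {fx} rxy => [x||//] x0.
    case: y y0 {gy} => [y||//] y0 rxy.
      exists (x - (x + y - r) / 2)%R; first by rewrite lte_fin; move: rxy;
        rewrite -EFinD lte_fin; lra.
      exists (y - (x + y - r) / 2)%R; first by rewrite lte_fin; move: rxy;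
        rewrite -EFinD lte_fin; lra.
      by move: rxy; rewrite -EFinD lte_fin; lra.
    exists (x - 1)%R; first by rewrite lte_fin; lra.
    by exists (r - x + 1)%R; [exact: ltry|lra].
  move=> _; exists (r + 1)%R; first exact: ltry.
  exists (-1)%R; last by lra.
  by apply: lt_le_trans y0; rewrite lte_fin; lra.
apply: (filterS _ (filterI (fx b bx) (gy c cy))) => t [/= bf cg].
by apply: le_lt_trans (lteD bf cg); rewrite -EFinD lee_fin.
Qed.

(** At (0, +oo), where the product is discontinuous, the claimed lower limit is 0 * oo = 0 and
    follows from nonnegativity alone. *)
Lemma lower_limitM f g x y : 0 <= x -> 0 <= y ->
  (\forall t \near F, 0 <= f t) -> (\forall t \near F, 0 <= g t) ->
  lower_limit f x -> lower_limit g y ->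
    lower_limit (fun t => f t * g t) (x * y).
Proof.
move=> x0 y0 f0 g0 fx gy r rxy.
have [r0|r0] := ltP r 0%R.
  apply: (filterS _ (filterI f0 g0)) => t [/= ft gt].
  by apply: (@lt_le_trans _ _ 0); rewrite ?lte_fin// mule_ge0.
have xy0 : 0 < x * y by rewrite (le_lt_trans _ rxy)// lee_fin.
have x_gt0 : 0 < x by rewrite lt0e x0 andbT; apply: contraTN xy0 => /eqP ->;
  rewrite mul0e ltxx.
have y_gt0 : 0 < y by rewrite lt0e y0 andbT; apply: contraTN xy0 => /eqP ->;
  rewrite mule0 ltxx.
(* First c below y with r < x c, then b below x with r < b c; both are real even if x or y is
   +oo. *)
have [c c0 [cy rxc]] : exists2 c : R, (0 < c)%R & c%:E < y /\ r%:E < x * c%:E.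
  case: x x_gt0 rxy {x0 fx xy0} => [x||//].
    rewrite lte_fin => x_gt0 rxy.
    have [c rc cy] : exists2 c : R, (r / x < c)%R & c%:E < y.
      apply: lt_EFin_between; case: y y_gt0 rxy {y0 gy} => [y||//] _;
        last by rewrite ltry.
      by rewrite -EFinM !lte_fin ltr_pdivrMr// mulrC.
    exists c; first by rewrite (le_lt_trans _ rc)// divr_ge0// ltW.
    by split => //; rewrite -EFinM lte_fin mulrC -ltr_pdivrMr.
  move=> _ _; have [c c0 cy] := lt_EFin_between y_gt0.
  by exists c => //; split => //; rewrite gt0_mulye ?lte_fin ?ltry.
have [b rb bx] : exists2 b : R, (r / c < b)%R & b%:E < x.
  apply: lt_EFin_between; case: x x_gt0 rxc {x0 fx xy0 rxy} => [x||//] _;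
    last by rewrite ltry.
  by rewrite -EFinM !lte_fin ltr_pdivrMr.
have b0 : (0 < b)%R by rewrite (le_lt_trans _ rb)// divr_ge0// ltW.
apply: (filterS _ (filterI (fx b bx) (gy c cy))) => t [/= bf cg].
apply: (@lt_le_trans _ _ (b%:E * c%:E)).
  by rewrite -EFinM lte_fin -ltr_pdivrMr.
by apply: lee_pmul; rewrite ?lee_fin ?ltW.
Qed.

Lemma lower_limit_sum (I : Type) (s : seq I) (Q : pred I)
    (f : I -> T -> \bar R) (l : I -> \bar R) :
  (forall i, Q i -> 0 <= l i) -> (forall i, Q i -> lower_limit (f i) (l i)) ->
  lower_limit (fun t => \sum_(i <- s | Q i) f i t) (\sum_(i <- s | Q i) l i).
Proof.
move=> l0 fl; elim: s => [|i s IH].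
  by move=> r; rewrite big_nil => r0; apply: nearW => t; rewrite big_nil.
move=> r; rewrite big_cons; case: ifPn => Qi rl.
  have s0 : 0 <= \sum_(i <- s | Q i) l i by exact: sume_ge0.
  apply: (filterS _ (lower_limitD (l0 i Qi) s0 (fl i Qi) IH rl)) => t.
  by rewrite big_cons Qi.
by apply: (filterS _ (IH r rl)) => t; rewrite big_cons (negbTE Qi).
Qed.

End lower_limits.

(** The function is -1/b for b < 0 and +oo for b >= 0; at 0 the two pieces agree because -1/b tends
    to +oo from the left. *)
Lemma exp_int_continuous (R : realType) : continuous (@exp_int R : R -> \bar R).
Proof.
move=> b; have [b0|b0] := ltP b 0%R.
  rewrite /continuous_at exp_int_lt0//;
    have E : \forall x \near b, ((- x)^-1)%:E = exp_int x.
    by near=> x; rewrite exp_int_lt0//; near: x; exact: lt_nbhsl.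
  apply: cvg_trans; first exact: (near_eq_cvg E).
  apply: cvg_EFin; first exact: nearW.
  by apply: cvgV; [rewrite oppr_eq0 lt_eqF|exact: cvgN].
rewrite /continuous_at exp_int_ge0//; apply/cvgeyPgt => A.
near=> x; have [x0|x0] := ltP x 0%R; last by rewrite exp_int_ge0// ltry.
rewrite exp_int_lt0// lte_fin.
have A0 : (0 < `|A| + 1)%R by rewrite ltr_wpDl.
rewrite (@le_lt_trans _ _ `|A|%R)// ?ler_norm// (@lt_trans _ _ (`|A| + 1)%R)// ?ltrDl//.
rewrite -[ltLHS]invrK ltf_pV2 ?posrE ?invr_gt0 ?oppr_gt0// ltrNl.
near: x; apply: lt_nbhsr; rewrite (lt_le_trans _ b0)// oppr_lt0 invr_gt0//.
Unshelve. all: by end_near. Qed.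

(** The nested nonempty sublevel sets generate a proper filter, which clusters at a point of A;
    lower semicontinuity puts that point in every sublevel set. With phi fixed and c decreasing this
    yields minimisers; with phi varying and c fixed it yields the action needed at the limit of a
    sequence of g. *)
Lemma compact_lower_limit (R : realType) (X : topologicalType) (A : set X)
    (phi : nat -> X -> \bar R) (c : nat -> \bar R) :
  compact A ->
  (forall n x, A x -> lower_limit (within A (nbhs x)) (phi n) (phi n x)) ->
  (forall n x, A x -> 0 <= phi n x) ->
  (forall n x, A x -> phi n.+1 x <= c n.+1 -> phi n x <= c n) ->
  (forall n, exists2 x, A x & phi n x <= c n) ->
  exists2 x, A x & forall n, phi n x <= c n.
Proof.
move=> cA lsc phi0 nested ne.
pose K n := [set x | A x /\ phi n x <= c n].
have K_nd m n : (m <= n)%N -> K n `<=` K m.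
  elim: n => [|n IH]; first by rewrite leqn0 => /eqP ->.
  rewrite leq_eqVlt => /predU1P[->//|]; rewrite ltnS => /IH KK.
  by move=> x [Ax hx]; apply: KK; split => //; exact: nested.
pose F := [set B : set X | exists n, K n `<=` B].
have FF : ProperFilter F.
  split; first by move=> [n Kn]; have [x Ax hx] := ne n; exact: Kn (conj Ax hx).
  split.
  - by exists 0%N.
  - move=> B B' [m KB] [n KB']; exists (maxn m n) => x Kx; split.
      by apply: KB; apply: K_nd Kx; exact: leq_maxl.
    by apply: KB'; apply: K_nd Kx; exact: leq_maxr.
  - by move=> B B' BB' [n KB]; exists n; exact: subset_trans BB'.
have [x [Ax clx]] : A `&` cluster F !=set0.
  by apply: cA; exists 0%N => x [].
exists x => // n; rewrite leNgt; apply/negP => cx.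
have [x' Ax' hx'] := ne n.
have c0 : 0 <= c n by rewrite (le_trans (phi0 n x' Ax')).
case cE : (c n) c0 cx => [r| |//] _; last by rewrite ltNge leey.
move=> /(lsc n x Ax) h.
have [y [[Ay hy] /= hn]] := clx (K n) _ (ex_intro _ n (@subset_refl _ _)) h.
by have := hn Ay; rewrite ltNge -cE hy.
Qed.

Section strict_supersolution.
Context (R : realType) (S : finType) (z : S) (B : S -> S -> R) (v : S -> R).
Hypothesis B_ge0 : forall i j, (0 <= B i j)%R.
Hypothesis v_ge0 : forall i, (0 <= v i)%R.
Hypothesis vE : forall i, (v i = B i z + \sum_(j | j != z) B i j * v j)%R.
Hypothesis B_reach : forall D : S -> Prop, D z ->
  (forall i j, D j -> 0 < B i j -> D i)%R -> forall i, D i.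
Hypothesis B_out : forall i, exists j, (0 < B i j)%R.

Let avoid_step (y : S -> R) i : R := (\sum_(j | j != z) B i j * y j)%R.

(* With [B] the operator avoiding z, [y = v + B v + ... + B^(N-1) v] satisfies
   [B y = y - v + B^N v], and [B^N v < v] once z is reachable in N steps. *)
Lemma strict_supersolution : exists2 y : S -> R, (forall i, 0 <= y i)%R &
  forall i, (\sum_(j | j != z) B i j * y j < y i)%R.
Proof.
pose V n := iter n avoid_step v.
have le_step y y' : (forall i, y i <= y' i)%R -> forall i,
  (avoid_step y i <= avoid_step y' i)%R.
  by move=> yy' i; apply: ler_sum => j _; exact: ler_wpM2l.
have V1 i : (V 1%N i <= v i)%R by rewrite /= [leRHS]vE /avoid_step lerDr.
have V_ge0 n i : (0 <= V n i)%R.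
  by elim: n i => [|n IH] i //=; apply: sumr_ge0 => j _; rewrite mulr_ge0.
have VS n i : (V n.+1 i <= V n i)%R.
  by elim: n i => [|n IH] i; [exact: V1|exact: le_step].
have V_nd m n i : (m <= n)%N -> (V n i <= V m i)%R.
  elim: n => [|n IH]; first by rewrite leqn0 => /eqP ->.
  by rewrite leq_eqVlt => /predU1P[->//|/IH]; apply: le_trans; exact: VS.
have lt_step i j n : j != z -> (0 < B i j)%R -> (V n j < v j)%R ->
  (V n.+1 i < v i)%R.
  move=> jz Bij Vj; apply: (@lt_le_trans _ _ (V 1%N i)); last exact: V1.
  rewrite /= /avoid_step (bigD1 j)//= [ltRHS](bigD1 j)//= ltr_leD//.
    by rewrite ltr_pM2l.
  by apply: ler_sum => k _; rewrite ler_wpM2l//; exact: (V_nd 0%N).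
have lt_z i : (0 < B i z)%R -> (V 1%N i < v i)%R.
  by move=> Biz; rewrite /= [ltRHS]vE ltrDr.
have D_all : forall i, i = z \/ exists n, (V n i < v i)%R.
  apply: B_reach; first by left.
  move=> i j Dj Bij; right; have [jz|jz] := eqVneq j z.
    by exists 1%N; apply: lt_z; rewrite -jz.
  by case: Dj => [/eqP|[n Vj]];
    [rewrite (negbTE jz)|exists n.+1; exact: lt_step Vj].
have {}D_all i : exists n, (V n i < v i)%R.
  have [j Bij] := B_out i; have [jz|jz] := eqVneq j z.
    by exists 1%N; apply: lt_z; rewrite -jz.
  by case: (D_all j) => [/eqP|[n Vj]];
    [rewrite (negbTE jz)|exists n.+1; exact: lt_step Vj].
have [n_ hn] := choice D_all.
pose N := (\max_i n_ i)%N.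
have VN i : (V N i < v i)%R.
  by apply: le_lt_trans (hn i); apply: V_nd; exact: leq_bigmax.
exists (fun i => \sum_(m < N) V m i)%R => i; first by apply: sumr_ge0 => m _.
have -> : (\sum_(j | j != z) B i j * \sum_(m < N) V m j = \sum_(m < N) V m.+1 i)%R.
  by under eq_bigr do rewrite mulr_sumr; rewrite exchange_big.
rewrite -(ltrD2l (V 0%N i)) -(big_ord_recl N (fun m => V m i))/= big_ord_recr/=.
by rewrite addrC ltrD2r.
Qed.

End strict_supersolution.

(** * Optimality equations *)

Section lambda_exp.
Context (R : realType) (lambda : R).
Hypothesis lambda_gt0 : (0 < lambda)%R.
Implicit Types x y : \bar R.

Lemma mule_invK x : lambda%:E * ((lambda^-1)%:E * x) = x.
Proof. by rewrite muleA -EFinM divff ?gt_eqF// mul1e. Qed.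

Lemma le_expeM x y : (expeR (lambda%:E * x) <= expeR (lambda%:E * y)) =
  (x <= y).
Proof. by rewrite lee_expeR lee_pmul2l// lte_fin. Qed.

Lemma expeM_inj x y : expeR (lambda%:E * x) = expeR (lambda%:E * y) -> x = y.
Proof. by move=> xy; apply/le_anti;
  rewrite -(le_expeM x y) -(le_expeM y x) xy lexx. Qed.

Lemma expeM0 : expeR (lambda%:E * 0) = 1.
Proof. by rewrite mule0 expeR0. Qed.

(** Every y >= 0 is an exponential of an extended real, so the bound can be moved inside the infimum
    and back, infinite values included. *)
Lemma expeM_inf (A : set (\bar R)) y :
  (forall x, A x -> y <= expeR (lambda%:E * x)) ->
  y <= expeR (lambda%:E * ereal_inf A).
Proof.
move=> yA; have [y0|y0] := leP 0 y;
  last by rewrite (le_trans (ltW y0))// expeR_ge0.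
have [x xy] := expeR_total y0; rewrite -xy -(mule_invK x) le_expeM.
by apply: le_ereal_inf_tmp => t At; rewrite -le_expeM mule_invK xy yA.
Qed.

End lambda_exp.

Section model.
Context (R : realType) (S : finType) (X : completePseudoMetricType R)
  (M : ctmdm S X) (lambda : R) (lambda_gt0 : (0 < lambda)%R)
  (d : measure_display) (Omega : measurableType d) (xi : R -> Omega -> S)
  (P : (S -> X) -> S -> probability Omega R)
  (xi_rc : right_continuous_process xi)
  (xi_ctmc : forall (f : S -> X) (i : S), policies M f ->
     is_ctmc xi (rate_of M f) i (P f i))
  (card_S : (1 < #|S|)%N)
  (irr : forall f : S -> X, policies M f -> irreducible_rates (rate_of M f))
  (z : S).
Implicit Types (f : S -> X) (g : R) (i j k : S) (u : S -> \bar R).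

Definition exponent g i (a : X) :
  R := (lambda * (cost M i a - g) + rate M i i a)%R.

Definition policy_weight g f :=
  rate_weight (rate_of M f) (fun k => lambda * (cost M k (f k) - g))%R.

Lemma QE i a g : Q M lambda i a g = exp_int (exponent g i a).
Proof. by apply: eq_integral => s _; rewrite mulrDl. Qed.

Lemma policy_weightE g f k j : policy_weight g f k j =
  if j == k then 0 else Q M lambda k (f k) g * (rate M j k (f k))%:E.
Proof. by rewrite QE. Qed.

Lemma Q_gt0 i a g : 0 < Q M lambda i a g.
Proof. by rewrite QE exp_int_gt0. Qed.

Lemma policy_rate_ge0 f k j :
  policies M f -> j != k -> (0 <= rate_of M f j k)%R.
Proof. by move=> fM; exact: rate_ge0. Qed.

Lemma policy_weight_ge0 g f k j : policies M f -> 0 <= policy_weight g f k j.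
Proof.
by move=> fM; apply: rate_weight_ge0 => // l m; exact: policy_rate_ge0.
Qed.

(** Since the diagonal weight is 0, the separate equations for i = z and i != z become a single
    one. *)
Lemma bellman_hit_step g f u i : policies M f -> (forall j, 0 <= u j) ->
  bellman M lambda z g u i (f i) = hit_step z (policy_weight g f) u i.
Proof.
move=> fM u0; rewrite /bellman /hit_step policy_weightE eq_sym.
have Q0 := ltW (Q_gt0 i (f i) g).
have q0 j : j != i -> 0 <= (rate M j i (f i))%:E.
  by move=> ji; rewrite lee_fin; exact: policy_rate_ge0.
case: eqVneq => [zi|iz].
  rewrite add0e zi ge0_sume_distrr; last first.
    by move=> j jz; rewrite mule_ge0// q0// -zi.
  by apply: eq_bigr => j jz;
    rewrite policy_weightE (negbTE jz) -muleA [u j * _]muleC.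
rewrite ge0_muleDr//; last 2 first.
- by rewrite q0.
- by rewrite sume_ge0// => j /andP[ji _]; rewrite mule_ge0// q0.
congr (_ + _); rewrite ge0_sume_distrr; last first.
  by move=> j /andP[ji _]; rewrite mule_ge0// q0.
rewrite [RHS](bigD1 i) 1?eq_sym//= policy_weightE eqxx mul0e add0e.
apply: eq_big => [j|j /andP[ji _]]; first by rewrite andbC.
by rewrite policy_weightE (negbTE ji) -muleA [u j * _]muleC.
Qed.

Lemma policy_diag_lt0 f k : policies M f -> (rate_of M f k k < 0)%R.
Proof.
move=> fM; apply: (irreducible_diag_lt0 (irr fM)) => // [l j|l].
  exact: policy_rate_ge0.
exact: rate_sum0.
Qed.

(** The bridge from probability to nonnegative matrices: all later statements about h, h* and [G] go
    through [hit]. *)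
Lemma exp_h_hit g f i : policies M f ->
  exp_h M lambda xi P z g f i = hit z (policy_weight g f) i.
Proof.
move=> fM; rewrite /exp_h /h mule_invK//.
have -> : \int[P f i]_w expeR (lambda%:E * passage_cost M xi z g f w) =
    hit z (policy_weight g f) i.
  apply: (expectation_hit xi_rc (xi_ctmc i fM)) => //.
  - by move=> k; exact: policy_diag_lt0.
  - by move=> k j; exact: policy_rate_ge0.
  - by move=> k; exact: rate_sum0.
  - exact: irr.
  - by move=> w; exact: expeR_ge0.
  move=> s w zs sw; rewrite /passage_cost.
  rewrite (@tau_on_path _ _ _ _ _ _ _ _ _ _ sw); last 3 first.
  - by rewrite size_rcons.
  - move=> [//|m] /= msz; rewrite size_rcons ltnS in msz.
    by rewrite nth_rcons msz => mz; move: zs; rewrite -mz mem_nth.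
  - by rewrite size_rcons /= nth_rcons ltnn eqxx.
  have [_ ->] := @passage_integral _ _ _ _ _ (fun k => cost M k (f k) - g)%R _ _ _ sw.
  rewrite -EFinM /=; congr (_%:E); rewrite mulr_sumr expR_sum.
  by apply: eq_bigr => l _; rewrite mulrA.
have h0 : 0 <= hit z (policy_weight g f) i.
  by apply: hit_ge0 => k j; exact: policy_weight_ge0.
by apply/eqP; rewrite lneK_eq.
Qed.

Lemma exp_h_ge0 g f i : 0 <= exp_h M lambda xi P z g f i.
Proof. exact: expeR_ge0. Qed.

Lemma exp_hstar_ge0 g i : 0 <= exp_hstar M lambda xi P z g i.
Proof. exact: expeR_ge0. Qed.

Lemma exp_hstar_le g f i : policies M f ->
  exp_hstar M lambda xi P z g i <= hit z (policy_weight g f) i.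
Proof.
move=> fM; rewrite -exp_h_hit// le_expeM//; apply: ereal_inf_lbound;
  by exists f.
Qed.

Lemma le_exp_hstar g i y :
  (forall f, policies M f -> y <= hit z (policy_weight g f) i) ->
  y <= exp_hstar M lambda xi P z g i.
Proof.
by move=> hy; apply: expeM_inf => // _ [f fM <-];
  rewrite -/(exp_h _ _ _ _ _ _ _ _) exp_h_hit// hy.
Qed.

Lemma exp_h_bellman g f i : policies M f ->
  exp_h M lambda xi P z g f i =
  bellman M lambda z g (exp_h M lambda xi P z g f) i (f i).
Proof.
move=> fM; rewrite bellman_hit_step//; last by move=> j; exact: exp_h_ge0.
rewrite exp_h_hit// hit_stepE; last by move=> k j; exact: policy_weight_ge0.
by congr (hit_step _ _ _ _); apply/funext => j; rewrite exp_h_hit.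
Qed.

Lemma policy_exists : exists f, policies M f.
Proof.
by have [f fM] := choice (fun i => adm_neq0 M i); exists f.
Qed.

Lemma le_bellman g u u' i a : adm M i a -> (forall j, 0 <= u j) ->
  (forall j, u j <= u' j) ->
    bellman M lambda z g u i a <= bellman M lambda z g u' i a.
Proof.
move=> ia u0 uu'; have u'0 j : 0 <= u' j by exact: le_trans (uu' j).
have [f0 f0M] := policy_exists.
(* The action a is completed to a policy, so that monotonicity of [hit_step] applies. *)
pose f k := if k == i then a else f0 k.
have fM : policies M f by move=> k; rewrite /f; case: eqVneq => [->|].
have <- : f i = a by rewrite /f eqxx.
by rewrite !bellman_hit_step//; apply: le_hit_step => // k j;
  exact: policy_weight_ge0.
Qed.

Lemma hit_le_bellman g f u : policies M f -> (forall j, 0 <= u j) ->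
  (forall i, bellman M lambda z g u i (f i) <= u i) ->
  forall i, hit z (policy_weight g f) i <= u i.
Proof.
move=> fM u0 fu; apply: hit_le => // [k j|i]; first exact: policy_weight_ge0.
by rewrite -bellman_hit_step.
Qed.

Lemma bellman_inf_le g i :
  bellman_inf M lambda xi P z g i <= exp_hstar M lambda xi P z g i.
Proof.
apply: le_exp_hstar => f fM; rewrite -exp_h_hit// exp_h_bellman//.
apply: (@le_trans _ _ (bellman M lambda z g (exp_hstar M lambda xi P z g) i (f i))).
  by apply: ereal_inf_lbound; exists (f i).
apply: le_bellman => // j; first exact: exp_hstar_ge0.
by rewrite exp_h_hit// exp_hstar_le.
Qed.

Lemma attains_min_hit g f : policies M f -> attains_min M lambda xi P z g f ->
  forall i, hit z (policy_weight g f) i = exp_hstar M lambda xi P z g i.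
Proof.
move=> fM fmin i; apply/eqP; rewrite eq_le exp_hstar_le// andbT.
apply: hit_le_bellman => // j; first exact: exp_hstar_ge0.
by rewrite fmin bellman_inf_le.
Qed.

(** * Monotonicity in g, semicontinuity and minimising policies *)

Hypothesis adm_compact : forall i, compact (adm M i).
Hypothesis cost_cont : forall i, {within adm M i, continuous (cost M i)}.
Hypothesis rate_cont : forall i j, {within adm M i, continuous (rate M j i)}.

Lemma le_Q i a g g' : (g <= g')%R -> Q M lambda i a g' <= Q M lambda i a g.
Proof.
move=> gg'; rewrite !QE; apply: le_exp_int.
by rewrite lerD2r ler_pM2l// lerD2l lerN2.
Qed.

Lemma le_policy_weight g g' f k j : policies M f -> (g <= g')%R ->
  policy_weight g' f k j <= policy_weight g f k j.
Proof.
move=> fM gg'; rewrite !policy_weightE; case: eqVneq => // jk.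
by rewrite lee_wpmul2r ?le_Q// lee_fin; exact: policy_rate_ge0.
Qed.

Lemma le_exp_hstar_g g g' i : (g <= g')%R ->
  exp_hstar M lambda xi P z g' i <= exp_hstar M lambda xi P z g i.
Proof.
move=> gg'; apply: le_exp_hstar => f fM;
  apply: (le_trans (exp_hstar_le _ _ fM)).
by apply: le_hit => k j; [exact: policy_weight_ge0|exact: le_policy_weight].
Qed.

Lemma le_bellman_g g g' u i a :
  adm M i a -> (forall j, 0 <= u j) -> (g <= g')%R ->
  bellman M lambda z g' u i a <= bellman M lambda z g u i a.
Proof.
move=> ia u0 gg'; have q0 j : j != i -> 0 <= (rate M j i a)%:E.
  by move=> ji; rewrite lee_fin; exact: rate_ge0.
rewrite /bellman; case: eqVneq => [iz|iz]; subst.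
  apply: lee_wpmul2r; last exact: le_Q.
  by apply: sume_ge0 => j jz; rewrite mule_ge0// q0.
apply: lee_wpmul2r; last exact: le_Q.
rewrite adde_ge0// ?q0 1?eq_sym// sume_ge0// => j /andP[ji _].
by rewrite mule_ge0// q0.
Qed.

Lemma G_exp_hstar g : G M lambda xi P z g <-> exp_hstar M lambda xi P z g z <=
  1.
Proof. by rewrite /exp_hstar -[X in _ <= X](expeM0 lambda) le_expeM. Qed.

Lemma bellman_ge0 g u i a : adm M i a -> (forall j, 0 <= u j) ->
  0 <= bellman M lambda z g u i a.
Proof.
move=> ia u0; have q0 j : j != i -> 0 <= (rate M j i a)%:E.
  by move=> ji; rewrite lee_fin; exact: rate_ge0.
rewrite /bellman; case: eqVneq => [iz|iz]; subst.
  by rewrite mule_ge0 ?(ltW (Q_gt0 _ _ _))// sume_ge0// => j jz;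
    rewrite mule_ge0// q0.
rewrite mule_ge0 ?(ltW (Q_gt0 _ _ _))// adde_ge0// ?q0 1?eq_sym// sume_ge0// => j /andP[ji _].
by rewrite mule_ge0// q0.
Qed.

(** Action, g and u may all vary, which covers both semicontinuity in the action and the limit of
    (g_m, h*_(g_m)) at a fixed action. *)
Lemma bellman_lower_limit (T : Type) (F : set_system T) (FF : Filter F)
    (a_ : T -> X) (g_ : T -> R) (u_ : T -> S -> \bar R) g u i a :
  adm M i a -> (\forall t \near F, adm M i (a_ t)) ->
  (forall t j, 0 <= u_ t j) -> (forall j, 0 <= u j) ->
  (forall j, lower_limit F (fun t => u_ t j) (u j)) ->
  Q M lambda i (a_ t) (g_ t) @[t --> F] --> Q M lambda i a g ->
  (forall j, rate M j i (a_ t) @[t --> F] --> rate M j i a) ->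
  lower_limit F (fun t => bellman M lambda z (g_ t) (u_ t) i (a_ t))
    (bellman M lambda z g u i a).
Proof.
move=> ia ia_ u_0 u0 ul Ql rl.
have q0 j : j != i -> 0 <= (rate M j i a)%:E.
  by move=> ji; rewrite lee_fin; exact: rate_ge0.
have q_0 j : j != i -> \forall t \near F, 0 <= (rate M j i (a_ t))%:E.
  by move=> ji; apply: (filterS _ ia_) => t iat; rewrite lee_fin;
    exact: rate_ge0.
have qlim j : lower_limit F (fun t => (rate M j i (a_ t))%:E) (rate M j i a)%:E.
  by apply: lower_limit_cvg; apply: cvg_EFin; [exact: nearW|exact: rl].
have uqlim j : j != i ->
    lower_limit F (fun t => u_ t j * (rate M j i (a_ t))%:E) (u j * (rate M j i a)%:E).
  by move=> ji; apply: lower_limitM => //; [exact: q0|exact: nearW|exact: q_0].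
have uq0 j : j != i -> 0 <= u j * (rate M j i a)%:E by move=> ji;
  rewrite mule_ge0// q0.
have sum_ge0 (Pj : pred S) : (forall j, Pj j -> j != i) ->
    \forall t \near F, 0 <= \sum_(j | Pj j) u_ t j * (rate M j i (a_ t))%:E.
  move=> Pji; apply: (filterS _ ia_) => t iat; apply: sume_ge0 => j /Pji ji.
  by rewrite mule_ge0// lee_fin; exact: rate_ge0.
have Qlim := lower_limit_cvg Ql.
rewrite /bellman; case: eqVneq => [iz|iz]; subst.
  apply: lower_limitM => //.
  - exact/ltW/Q_gt0.
  - by apply: sume_ge0 => j jz; exact: uq0.
  - by apply: nearW => t; exact/ltW/Q_gt0.
  - exact: sum_ge0.
  - by apply: lower_limit_sum.
have zi : z != i by rewrite eq_sym.
apply: lower_limitM => //.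
- exact/ltW/Q_gt0.
- by rewrite adde_ge0 ?q0// sume_ge0// => j /andP[ji _]; exact: uq0.
- by apply: nearW => t; exact/ltW/Q_gt0.
- apply: (filterS _ (filterI (q_0 z zi) (sum_ge0 (fun j => (j != i) && (j != z)) _))).
    by move=> t [/= ? ?]; exact: adde_ge0.
  by move=> j /andP[].
- apply: lower_limitD => //; first exact: q0.
    by apply: sume_ge0 => j /andP[ji _]; exact: uq0.
  by apply: lower_limit_sum => j /andP[ji _]; [exact: uq0|exact: uqlim].
Qed.

Lemma exponent_cvg g i a : adm M i a ->
  exponent g i b @[b --> within (adm M i) (nbhs a)] --> exponent g i a.
Proof.
move=> ia; apply: cvgD;
  last exact: (subspace_continuousP _ _).1 (@rate_cont i i) a ia.
apply: cvgMl_tmp; apply: cvgB; last exact: cvg_cst.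
exact: (subspace_continuousP _ _).1 (@cost_cont i) a ia.
Qed.

Lemma Q_within g i a : adm M i a ->
  Q M lambda i b g @[b --> within (adm M i) (nbhs a)] --> Q M lambda i a g.
Proof.
move=> ia; rewrite (_ : (fun b => Q M lambda i b g) = @exp_int R \o exponent g i); last first.
  by apply/funext => b; rewrite QE.
rewrite QE; apply: cvg_comp; [exact: exponent_cvg|exact: exp_int_continuous].
Qed.

Lemma bellman_within g u i a : adm M i a -> (forall j, 0 <= u j) ->
  lower_limit (within (adm M i) (nbhs a)) (bellman M lambda z g u i)
    (bellman M lambda z g u i a).
Proof.
move=> ia u0; apply: (@bellman_lower_limit _ _ _ id (fun=> g) (fun=> u)) => //.
- exact: withinT.
- by move=> j; exact: lower_limit_cst.
- exact: Q_within.
- by move=> j; exact: (subspace_continuousP _ _).1 (@rate_cont i j) a ia.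
Qed.

Lemma lower_semicontinuous_bellman g u i : (forall j, 0 <= u j) ->
  lower_semicontinuous (bellman M lambda z g u i : subspace (adm M i) -> \bar R).
Proof.
move=> u0 x r rx; have [ix|nix] := pselect (adm M i x).
  exists [set y | r%:E < bellman M lambda z g u i y] => //.
  have := bellman_within ix u0 rx.
  by rewrite [X in X -> _](_ : _ = nbhs_subspace (x : subspace (adm M i))
    [set y | r%:E < bellman M lambda z g u i y])// -nbhs_subspace_in.
(* Points outside [adm M i] are isolated in the subspace topology. *)
exists [set x]; last by move=> y ->.
by rewrite /nbhs/= -nbhs_subspace_out.
Qed.

Lemma attains_min_exists g :
  exists2 f, policies M f & attains_min M lambda xi P z g f.
Proof.
have V0 := exp_hstar_ge0 g.
suff /choice[f hf] : forall i, exists a, adm M i a /\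
    bellman M lambda z g (exp_hstar M lambda xi P z g) i a =
      bellman_inf M lambda xi P z g i.
  by exists f => i; have [] := hf i.
move=> i; set m := bellman_inf _ _ _ _ _ _ _.
have m_le a : adm M i a ->
  m <= bellman M lambda z g (exp_hstar M lambda xi P z g) i a.
  by move=> ia; apply: ereal_inf_lbound; exists a.
have m0 : 0 <= m.
  by apply: le_ereal_inf_tmp => _ [a ia <-]; exact: bellman_ge0.
case mE : m m0 => [r| |//] _; last first.
  have [a ia] := adm_neq0 M i; exists a; split => //.
  by apply/eqP; rewrite -leye_eq -mE m_le.
pose phi := bellman M lambda z g (exp_hstar M lambda xi P z g) i.
(* The levels r + 1/(n+1) lie strictly above the finite infimum r, so their sublevel sets are
   nonempty. *)
have [a ia ha] : exists2 a, adm M i a & forall n : nat,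
  phi a <= (r + n.+1%:R^-1)%:E.
  apply: (@compact_lower_limit R X (adm M i) (fun=> phi)) => //.
  - by move=> _ x ix; exact: bellman_within.
  - by move=> _ x ix; exact: bellman_ge0.
  - move=> n x ix /le_trans; apply; rewrite lee_fin lerD2l lef_pV2 ?posrE//.
    by rewrite ler_nat.
  - move=> n; have : m < (r + n.+1%:R^-1)%:E by rewrite mE lte_fin ltrDl.
    by move=> /ereal_inf_lt[_ [a ia <-] /ltW]; exists a.
exists a; split => //; apply/eqP; rewrite eq_le -{2}mE m_le// andbT.
apply/lee_addgt0Pr => e e0.
have [n _ /(_ n (leqnn n)) /= ne] := near_infty_natSinv_lt (PosNum e0).
by rewrite (le_trans (ha n))// -EFinD lee_fin lerD2l ltW.
Qed.

Lemma exp_hstar_bellman g i :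
  exp_hstar M lambda xi P z g i = bellman_inf M lambda xi P z g i.
Proof.
have [f fM fmin] := attains_min_exists g;
  rewrite -fmin -(attains_min_hit fM fmin).
rewrite bellman_hit_step//; last exact: exp_hstar_ge0.
rewrite hit_stepE; last by move=> k j; exact: policy_weight_ge0.
by congr (hit_step _ _ _ _); apply/funext => j; rewrite attains_min_hit.
Qed.

Lemma policy_weight_gt0 g f k j : policies M f -> j != k ->
  (0 < rate_of M f j k)%R -> 0 < policy_weight g f k j.
Proof.
by move=> fM jk qjk; rewrite policy_weightE (negbTE jk) mule_gt0// ?Q_gt0 ?lte_fin.
Qed.

Lemma policy_weight_reach g f (D : S -> Prop) : policies M f -> D z ->
  (forall k j, D j -> 0 < policy_weight g f k j -> D k) -> forall k, D k.
Proof.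
move=> fM Dz DS; apply: (irreducible_reach (irr fM) _ Dz) => [k j|k j Dj jk qjk].
  exact: policy_rate_ge0.
by apply: DS Dj _; exact: policy_weight_gt0.
Qed.

Lemma policy_successor f k : policies M f ->
  exists2 j, j != k & (0 < rate_of M f j k)%R.
Proof.
move=> fM; apply: contrapT => none.
have := policy_diag_lt0 k fM.
have -> : rate_of M f k k = (- \sum_(j | j != k) rate_of M f j k)%R.
  have := rate_sum0 (fM k); rewrite (bigD1 k)//= => /eqP.
  by rewrite addr_eq0 => /eqP.
rewrite big1 ?oppr0 ?ltxx// => j jk; apply/eqP;
  rewrite eq_le policy_rate_ge0// andbT leNgt.
by apply/negP => qjk; apply: none; exists j.
Qed.

Lemma policy_hit_gt0 g f k : policies M f -> 0 < hit z (policy_weight g f) k.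
Proof.
move=> fM; apply: hit_gt0 => [l j|D|l]; first exact: policy_weight_ge0.
  exact: policy_weight_reach.
have [j jl qjl] := policy_successor l fM.
by exists j; exact: policy_weight_gt0.
Qed.

Lemma policy_hit_fin g f : policies M f -> hit z (policy_weight g f) z < +oo ->
  forall k, hit z (policy_weight g f) k < +oo /\ Q M lambda k (f k) g < +oo.
Proof.
move=> fM hz; have w0 k j := policy_weight_ge0 g k j fM.
have h0 k := hit_ge0 z k w0.
have lt_ypmul (x y : \bar R) :
  0 < x -> 0 < y -> x * y < +oo -> x < +oo /\ y < +oo.
  move=> x0 y0; case: x x0 => [x| |//]; case: y y0 => [y| |//] //.
  - by rewrite !ltry.
  - by move=> _ x0; rewrite gt0_muley.
  - by move=> y0 _; rewrite gt0_mulye.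
have step k j : hit z (policy_weight g f) k < +oo -> j != k ->
  (0 < rate_of M f j k)%R ->
    hit z (policy_weight g f) j < +oo /\ Q M lambda k (f k) g < +oo.
  move=> hk jk qjk; have wkj := policy_weight_gt0 g fM jk qjk.
  suff [wy hj] : policy_weight g f k j < +oo /\ hit z (policy_weight g f) j < +oo.
    split => //; move: wy; rewrite policy_weightE (negbTE jk).
    by move=> /lt_ypmul[]; rewrite ?Q_gt0 ?lte_fin.
  have [jz|jz] := eqVneq j z.
    subst j; split => //; apply: le_lt_trans hk;
      rewrite [leRHS]hit_stepE// leeDl//.
    by apply: sume_ge0 => l _; rewrite mule_ge0.
  apply: lt_ypmul => //; first exact: policy_hit_gt0.
  apply: le_lt_trans hk;
    rewrite [leRHS]hit_stepE// /hit_step (bigD1 j)//= addeCA leeDl//.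
  by rewrite adde_ge0// sume_ge0// => l _; rewrite mule_ge0.
(* By [step], the states with infinite value are closed under predecessors; if there were one,
   irreducibility would make the value at z infinite too. *)
have all_fin : forall k, hit z (policy_weight g f) k < +oo.
  move=> k; apply: contrapT => nk.
  suff : forall l, ~ (hit z (policy_weight g f) l < +oo) by move/(_ z).
  apply: (irreducible_reach (irr fM) _ nk) => [l j|l j nj jl qjl hl].
    exact: policy_rate_ge0.
  by apply: nj; have [] := step l j hl jl qjl.
move=> k; split => //; have [j jk qjk] := policy_successor k fM.
by have [] := step k j (all_fin k) jk qjk.
Qed.

Lemma attains_min_fin g f : G M lambda xi P z g -> policies M f ->
  attains_min M lambda xi P z g f -> forall i,
  [/\ h M lambda xi P z g i f = hstar M lambda xi P z g i,
      hstar M lambda xi P z g i \is a fin_num &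
      Q M lambda i (f i) g < +oo].
Proof.
move=> /G_exp_hstar Gg fM fmin i.
have hz : hit z (policy_weight g f) z < +oo.
  by rewrite (attains_min_hit fM fmin) (le_lt_trans Gg) ?ltry.
have [hi Qi] := policy_hit_fin fM hz i; have h0 := policy_hit_gt0 g i fM.
split => //.
  apply: (expeM_inj lambda_gt0); rewrite -/(exp_h _ _ _ _ _ _ _ _) exp_h_hit//.
  by rewrite (attains_min_hit fM fmin).
(* Finiteness of the exponential excludes h* = +oo, and its positivity excludes h* = -oo. *)
move: hi h0; rewrite (attains_min_hit fM fmin) /exp_hstar.
case: (hstar _ _ _ _ _ _ _) => [//| |].
  by rewrite gt0_muley ?lte_fin//= ltxx.
by rewrite gt0_muleNy ?lte_fin//= ltxx.
Qed.

(** * The set G and its infimum *)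

Lemma cost_ub : exists C : R, forall i a, adm M i a -> (cost M i a <= C)%R.
Proof.
have /choice[c hc] : forall i, exists c : R, forall a,
  adm M i a -> (cost M i a <= c)%R.
  move=> i; have [a _ ha] := compact_EVT_max (adm_neq0 M i) (@adm_compact i) (@cost_cont i).
  by exists (cost M i a) => b ib; apply: ha; rewrite inE.
exists (\sum_j `|c j|)%R => i a ia; rewrite (le_trans (hc i a ia))//.
by rewrite (bigD1 i)//= (le_trans (ler_norm _))// lerDl sumr_ge0.
Qed.

(** By compactness lambda c(i,a) + q(i|i,a) is bounded below uniformly, so a negative exponent,
    which is what a finite [Q] means, forces g to be large. This is what bounds [G] from below. *)
Lemma exponent_lb : exists c : R, forall i a g,
  adm M i a -> (exponent g i a < 0)%R -> (c <= g)%R.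
Proof.
have /choice[c hc] : forall i, exists c : R, forall a,
  adm M i a -> (c <= exponent 0%R i a)%R.
  move=> i; have cont : {within adm M i, continuous (exponent 0%R i)}.
    by apply/subspace_continuousP => a ia; exact: exponent_cvg.
  have [a _ ha] := compact_EVT_min (adm_neq0 M i) (@adm_compact i) cont.
  by exists (exponent 0%R i a) => b ib; apply: ha; rewrite inE.
exists (- (\sum_j `|c j|) / lambda)%R => i a g ia.
have := hc i a ia; rewrite /exponent subr0 => ci eg.
have cS : (- c i <= \sum_j `|c j|)%R.
  by rewrite (bigD1 i)//= (le_trans (ler_norm _))// normrN lerDl sumr_ge0.
rewrite ler_pdivrMr//; rewrite mulrBr in eg; rewrite mulrC.
move: ci eg cS; move: (\sum_j _)%R (lambda * cost M i a)%R (lambda * g)%R (rate M i i a) (c i).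
by move=> *; lra.
Qed.

(** When g is an upper bound of the costs, the weights lie below the jump probabilities, so the
    constant 1 is a supersolution. *)
Lemma G_nonempty : G M lambda xi P z !=set0.
Proof.
have [C hC] := cost_ub; exists C; apply/G_exp_hstar.
have [f fM] := policy_exists; apply: (le_trans (exp_hstar_le _ _ fM)).
apply: (@hit_le _ _ _ _ (fun=> 1)) => // [k j|k];
  first exact: policy_weight_ge0.
rewrite -[leRHS](sum_rate_weight0 (fun j => policy_diag_lt0 j fM) (fun j => rate_sum0 (fM j)) k).
rewrite /hit_step [leRHS](bigD1 z)//=.
have w_le j : policy_weight C f k j <=
  rate_weight (rate_of M f) (fun=> 0%R) k j.
  rewrite /policy_weight /rate_weight; case: ifPn => // jk.
  apply: lee_wpmul2r; first by rewrite lee_fin policy_rate_ge0.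
  apply: le_exp_int; rewrite lerD2r pmulr_rle0// subr_le0; exact: hC.
by apply: leeD => //; apply: lee_sum => j _; rewrite mule1.
Qed.

Lemma G_up g g' : (g <= g')%R -> G M lambda xi P z g -> G M lambda xi P z g'.
Proof.
by move=> gg' /G_exp_hstar Gg; apply/G_exp_hstar/(le_trans _ Gg)/le_exp_hstar_g.
Qed.

Lemma G_has_lbound : has_lbound (G M lambda xi P z).
Proof.
have [c hc] := exponent_lb; exists c => g Gg.
have [f fM fmin] := attains_min_exists g.
have [_ _] := attains_min_fin Gg fM fmin z; rewrite QE => Qz.
by apply: (hc z (f z)) => //; rewrite ltNge;
  apply: contraTN Qz => /exp_int_ge0 ->.
Qed.

(* The sublevel sets of the one-step operators at g_m decrease with m; a common
   action gives a policy for which sup_m e^(lambda h*_(g_m)) is a supersolution at g. *)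
Lemma G_lim g (g_ : nat -> R) : (forall m, (g_ m.+1 <= g_ m)%R) ->
  g_ m @[m --> \oo] --> g -> (forall m, g <= g_ m)%R ->
  (forall m, G M lambda xi P z (g_ m)) -> G M lambda xi P z g.
Proof.
move=> g_dec g_lim g_ge Gg_; apply/G_exp_hstar.
pose V m i := exp_hstar M lambda xi P z (g_ m) i.
have V0 m i : 0 <= V m i by exact: exp_hstar_ge0.
have V_incr i : {homo V^~ i : m n / (m <= n)%N >-> m <= n}.
  apply: homo_leq => [x|x y t|m]; [exact: lexx|exact: le_trans|].
  exact: le_exp_hstar_g.
pose U i := ereal_sup (range (V^~ i)).
have VU m i : V m i <= U i by apply: ereal_sup_ubound; exists m.
have U0 i : 0 <= U i by exact: le_trans (VU 0%N i).
have /choice[f hf] : forall i, exists a, adm M i a /\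
    forall m, bellman M lambda z (g_ m) (V m) i a <= U i.
  move=> i; have [a ia ha] : exists2 a, adm M i a &
      forall m, bellman M lambda z (g_ m) (V m) i a <= U i.
    apply: (@compact_lower_limit R X (adm M i)
      (fun m => bellman M lambda z (g_ m) (V m) i) (fun=> U i) (@adm_compact i)).
    - by move=> m x ix; exact: bellman_within.
    - by move=> m x ix; exact: bellman_ge0.
    (* From m to m + 1, [V] increases and g decreases; both raise the one-step operator, so the
       sublevel sets shrink. *)
    - move=> m x ix; apply: le_trans.
      apply: (@le_trans _ _ (bellman M lambda z (g_ m) (V m.+1) i x)).
        exact: (le_bellman _ ix (V0 m) (fun j => V_incr j m m.+1 (leqnSn m))).
      exact: (le_bellman_g ix (V0 m.+1) (g_dec m)).
    (* A minimiser at g_m attains exactly [V m i], which is at most [U i]. *)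
    - move=> m; have [f fM fmin] := attains_min_exists (g_ m).
      by exists (f i) => //; rewrite fmin -exp_hstar_bellman; exact: VU.
  by exists a.
have fM : policies M f by move=> i; have [] := hf i.
have fU i : bellman M lambda z g U i (f i) <= U i.
  rewrite leNgt; apply/negP; case UE : (U i) (U0 i) => [r| |//] _;
    last by rewrite ltNge leey.
  have lim : lower_limit \oo (fun m => bellman M lambda z (g_ m) (V m) i (f i))
      (bellman M lambda z g U i (f i)).
    apply: (@bellman_lower_limit _ _ _ (fun=> f i)) => //.
    - by apply: nearW => _; exact: fM.
    - by move=> j; apply: lower_limit_cvg; exact: ereal_nondecreasing_cvgn.
    - rewrite (_ : (fun t => _) = @exp_int R \o (fun m => exponent (g_ m) i (f i))); last first.
        by apply/funext => m; rewrite QE.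
      rewrite QE; apply: cvg_comp; last exact: exp_int_continuous.
      apply: cvgD; last exact: cvg_cst.
      by apply: cvgMl_tmp; apply: cvgB; [exact: cvg_cst|exact: g_lim].
    - by move=> j; exact: cvg_cst.
  move=> /lim [N _ /(_ N (leqnn N))]; rewrite /= ltNge -UE.
  by have [_ ->] := hf i.
apply: (@le_trans _ _ (U z)).
  by apply: (le_trans (exp_hstar_le _ _ fM)); exact: hit_le_bellman.
apply: ge_ereal_sup => _ [m _ <-]; exact/G_exp_hstar.
Qed.

(** For a minimiser f, with v = e^(lambda h_g(., f)) finite, u = v + e y satisfies u > B u in every
    state and still u z <= 1; for this fixed u the strict inequalities survive a small decrease of
    g. *)
Lemma G_open_left g : exp_hstar M lambda xi P z g z < 1 ->
  exists2 g', (g' < g)%R & G M lambda xi P z g'.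
Proof.
move=> Vz1; have [f fM fmin] := attains_min_exists g.
have hz1 : hit z (policy_weight g f) z < 1 by rewrite (attains_min_hit fM fmin).
have hQ := policy_hit_fin fM (lt_trans hz1 (ltry _)).
have w0 k j := policy_weight_ge0 g k j fM.
have wfin k j : policy_weight g f k j \is a fin_num.
  rewrite policy_weightE; case: ifP => // _;
    rewrite fin_numM// ge0_fin_numE ?(hQ k).2//.
  exact/ltW/Q_gt0.
have hfin k : hit z (policy_weight g f) k \is a fin_num.
  by rewrite ge0_fin_numE ?(hQ k).1// hit_ge0.
pose B k j := fine (policy_weight g f k j).
have BE k j : policy_weight g f k j = (B k j)%:E by rewrite fineK.
pose v k := fine (hit z (policy_weight g f) k).
have hE k : hit z (policy_weight g f) k = (v k)%:E by rewrite fineK.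
have B0 k j : (0 <= B k j)%R by rewrite -lee_fin -BE.
have v0 k : (0 <= v k)%R by rewrite -lee_fin -hE hit_ge0.
have vS k : (v k = B k z + \sum_(j | j != z) B k j * v j)%R.
  apply: EFin_inj; rewrite -hE hit_stepE// /hit_step EFinD -sumEFin BE.
  by congr (_ + _); apply: eq_bigr => j _; rewrite BE hE.
have [||y y0 yB] := strict_supersolution B0 v0 vS.
- move=> D Dz DS; apply: (@policy_weight_reach g f D fM Dz) => k j Dj.
  by rewrite BE lte_fin; exact: DS.
- move=> k; have [j jk qjk] := policy_successor k fM; exists j.
  by rewrite -lte_fin -BE; exact: policy_weight_gt0.
have vz1 : (v z < 1)%R by rewrite -lte_fin -hE.
have yz1 : (0 < y z + 1)%R by rewrite ltr_wpDl.
(* This gives e * y z <= 1 - v z, hence u z <= 1; the added 1 keeps the denominator positive when y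
   z = 0. *)
pose e := ((1 - v z) / (y z + 1))%R.
have e0 : (0 < e)%R by rewrite divr_gt0// subr_gt0.
pose u k := (v k + e * y k)%:E.
have u0 k : 0 <= u k by rewrite lee_fin addr_ge0// mulr_ge0// ltW.
have uz1 : u z <= 1.
  rewrite lee_fin -lerBrDl /e mulrAC ler_pdivrMr// ler_pM2l ?subr_gt0//.
  by rewrite lerDl.
have gu k : bellman M lambda z g u k (f k) < u k.
  rewrite bellman_hit_step// /hit_step /u.
  rewrite (eq_bigr (fun j => (B k j * v j + e * (B k j * y j))%:E)); last first.
    by move=> j _; rewrite BE -EFinM mulrDr mulrCA.
  rewrite BE sumEFin -EFinD lte_fin big_split/= addrA -vS ltrD2l -mulr_sumr.
  by rewrite ltr_pM2l.
(* Only [Q] depends on g', and it multiplies a finite number, so genuine continuity holds here. *)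
have near_gu k : \forall g' \near g^'-, bellman M lambda z g' u k (f k) < u k.
  have lim : bellman M lambda z g' u k (f k) @[g' --> g^'-] --> bellman M lambda z g u k (f k).
    have Qlim j : Q M lambda k (f k) g' @[g' --> g^'-] --> Q M lambda k (f k) g.
      rewrite (_ : (fun t => _) = @exp_int R \o (fun g' => exponent g' k (f k))); last first.
        by apply/funext => g'; rewrite QE.
      rewrite QE; apply: cvg_comp; last exact: exp_int_continuous.
      apply: cvg_at_left_filter; apply: cvgD; last exact: cvg_cst.
      by apply: cvgMl_tmp; apply: cvgB; [exact: cvg_cst|exact: cvg_id].
    have ufin (Pj : pred S) :
      \sum_(j | Pj j) u j * (rate M j k (f k))%:E \is a fin_num.
      by apply/sum_fin_numP => j _ _; rewrite -EFinM.
    rewrite /bellman; case: eqVneq => [kz|kz]; subst.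
      by apply: cvgeZr => //; exact: Qlim.
    by apply: cvgeZr; [rewrite fin_numD ufin|exact: Qlim].
  apply: (lim [set t | t < u k]).
  by apply: open_nbhs_nbhs; split; [exact: open_ereal_lt_ereal|exact: gu].
have [g' [g'g hg']] : exists g', (g' < g)%R /\ forall k,
  bellman M lambda z g' u k (f k) < u k.
  have all_gu : \forall g' \near g^'-, forall k,
    bellman M lambda z g' u k (f k) < u k.
    exact: filter_forall.
  by apply: (@filter_ex _ (g^'-)); exact: filterI (nbhs_left_lt g) all_gu.
exists g' => //; apply/G_exp_hstar; apply: (le_trans (exp_hstar_le _ _ fM)).
by apply: (le_trans _ uz1); apply: hit_le_bellman => // k; exact/ltW.
Qed.

Lemma G_inf_attained :
  [/\ gbar M lambda xi P z = (inf (G M lambda xi P z))%:E,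
      G M lambda xi P z (inf (G M lambda xi P z)) &
      hstar M lambda xi P z (inf (G M lambda xi P z)) z = 0].
Proof.
set g0 := inf _.
have lb := G_has_lbound; have ne := G_nonempty.
have Gg0 : G M lambda xi P z g0.
  apply: (@G_lim g0 (fun m => g0 + m.+1%:R^-1)%R) => [m||m|m].
  - by rewrite lerD2l lef_pV2 ?posrE// ler_nat.
  - rewrite -[X in _ --> X]addr0; apply: cvgD; first exact: cvg_cst.
    exact: cvg_harmonic.
  - by rewrite lerDl.
  have m0 : (0 < m.+1%:R^-1 :> R)%R by rewrite invr_gt0.
  have [g Gg] := inf_adherent m0 (conj ne lb).
  by move=> /ltW gm; exact: G_up gm Gg.
split => //; first exact: ereal_inf_EFin.
apply: (expeM_inj lambda_gt0); rewrite expeM0 -/(exp_hstar _ _ _ _ _ _ _).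
apply/eqP; rewrite eq_le (G_exp_hstar g0).1//= leNgt;
  apply/negP => /G_open_left[g gg0 Gg].
by have := inf_lbound lb Gg; rewrite leNgt gg0.
Qed.

End model.

Theorem theorem3p1 (R : realType) (S : finType)
    (X : completePseudoMetricType R) (polishX : polish X)
    (M : ctmdm S X) (lambda : R) (lambda_gt0 : (0 < lambda)%R)
    (d : measure_display) (Omega : measurableType d) (xi : R -> Omega -> S)
    (P : (S -> X) -> S -> probability Omega R)
    (xi_rc : right_continuous_process xi)
    (xi_ctmc : forall (f : S -> X) (i : S), policies M f ->
       is_ctmc xi (rate_of M f) i (P f i))
    (card_S : (1 < #|S|)%N)
    (adm_compact : forall i : S, compact (adm M i))
    (cost_cont : forall i : S, {within adm M i, continuous (cost M i)})
    (rate_cont : forall i j : S, {within adm M i, continuous (rate M j i)})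
    (irr : forall f : S -> X, policies M f -> irreducible_rates (rate_of M f))
    (z : S) :
  [/\ (* (a) *)
      G M lambda xi P z !=set0,
      (* (b) *)
      forall (g : R) (f : S -> X), policies M f -> forall i : S,
        exp_h M lambda xi P z g f i =
        bellman M lambda z g (exp_h M lambda xi P z g f) i (f i),
      (* (c) *)
      (forall (g : R) (i : S),
         {within adm M i, continuous (fun a => Q M lambda i a g)}) /\
      (forall (g : R) (i : S),
         lower_semicontinuous
           (bellman M lambda z g (exp_hstar M lambda xi P z g) i
              : subspace (adm M i) -> \bar R)),
      (* (d) *)
      forall g : R, G M lambda xi P z g ->
        [/\ forall i : S,
              exp_hstar M lambda xi P z g i = bellman_inf M lambda xi P z g i,
            exists2 f : S -> X, policies M f & attains_min M lambda xi P z g f &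
            forall f : S -> X, policies M f -> attains_min M lambda xi P z g f ->
              forall i : S,
                [/\ h M lambda xi P z g i f = hstar M lambda xi P z g i,
                    hstar M lambda xi P z g i \is a fin_num &
                    Q M lambda i (f i) g < +oo]] &
      (* (e) *)
      exists g0 : R,
        [/\ gbar M lambda xi P z = g0%:E, G M lambda xi P z g0 &
            hstar M lambda xi P z g0 z = 0]].
Proof.
split.
- exact: (G_nonempty lambda_gt0 xi_rc xi_ctmc card_S irr z adm_compact cost_cont).
- move=> g f fM i.
  exact: (exp_h_bellman lambda_gt0 xi_rc xi_ctmc card_S irr).
- split=> g i; last first.
    apply: lower_semicontinuous_bellman => // j; exact: exp_hstar_ge0.
  by apply/subspace_continuousP => a ia; exact: Q_within.
- move=> g Gg; split.
  + move=> i.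
    exact: (exp_hstar_bellman lambda_gt0 xi_rc xi_ctmc card_S irr z adm_compact cost_cont rate_cont).
  + exact: attains_min_exists.
  + move=> f fM fmin i.
    exact: (attains_min_fin lambda_gt0 xi_rc xi_ctmc card_S irr Gg fM fmin).
- exists (inf (G M lambda xi P z)).
  exact: (G_inf_attained lambda_gt0 xi_rc xi_ctmc card_S irr z adm_compact cost_cont rate_cont).
Qed.
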